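(* Let $X$ be an NPC space, let $G$ be a totally disconnected, locally compact group acting properly and continuously by isometries on $X$, let $\xi \in \partial^{\mathrm{hyp}}_X G$ and let $S^+_{\xi}$ be the set of hyperbolic elements of $G$ with attracting point $\xi$. If $\xi \rightarrow \xi'$ for some $\xi' \in \partial^{\mathrm{hyp}}_X G$, then $s_G(g)=1$ for all $g \in S^+_{\xi}$; otherwise $s_G(g)>1$ for all $g \in S^+_{\xi}$. Moreover, if $G_{\xi}$ is open in $G$, then $s_G(g^{-1})=1$ for all $g \in S^+_{\xi}$; if $G_\xi$ is not open in $G$, then $s_G(g^{-1})>1$ for all $g \in S^+_{\xi}$.
   Context: An NPC space is a geodesic metric space $X$ that is either (a) complete and CAT(0), or (b) proper (closed balls are compact) and $\delta$-hyperbolic for some $\delta \ge 0$ (every geodesic triangle is $\delta$-thin: each point on a side lies within distance $\delta$ of a point on another side). The boundary $\partial X$ is the set of equivalence classes of geodesic rays, where $\gamma_1\sim\gamma_2$ if $d(\gamma_1(t),\gamma_2(t))$ is bounded over $t\ge 0$; isometries act on $\partial X$, and $G_\xi$ denotes the stabilizer of $\xi$ in $G$. Convergence of sequences in $X$ to boundary points is in the usual sense (cone topology for CAT(0) spaces, Gromov boundary for proper $\delta$-hyperbolic spaces). An isometry $g$ is hyperbolic if: in case (a), it has an axis, i.e. there are a geodesic line $\gamma:\mathbb{R}\to X$ and $k>0$ with $g\gamma(t)=\gamma(t+k)$ for all $t$; in case (b), $n\mapsto g^nx$ is a quasi-isometric embedding of $\mathbb{Z}$ into $X$ for some (equivalently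 any) $x$. A point $\xi\in\partial X$ is the attracting point $\xi_+(g)$ of $g$ if $g^nx\to\xi$ as $n\to+\infty$ for all $x\in X$; the repelling point is $\xi_-(g):=\xi_+(g^{-1})$. For hyperbolic $g$ both exist and are distinct. An isometric action of $G$ on $X$ is proper if for all $x\in X$, $r>0$ the set $\{g\in G: d(gx,x)\le r\}$ has compact closure. $\partial^{\mathrm{hyp}}_X G$ denotes the set of points of $\partial X$ that are limit points (attracting or repelling points) of hyperbolic elements of $G$. For $\xi_1,\xi_2\in\partial^{\mathrm{hyp}}_X G$, write $\xi_1\rightarrow\xi_2$ if every hyperbolic $h\in G$ with attracting point $\xi_1$ has repelling point $\xi_2$. The scale $s_G(g)$ is the minimum of $|gUg^{-1}:U\cap gUg^{-1}|$ over all compact open subgroups $U$ of $G$. *)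

(* Defs.v *)
From HB Require Import structures.
From mathcomp Require Import all_boot all_order all_algebra.
From mathcomp Require Import all_classical all_reals all_analysis.

Set Implicit Arguments.
Unset Strict Implicit.
Unset Printing Implicit Defensive.

Import Order.TTheory GRing.Theory Num.Theory.
Import numFieldNormedType.Exports.

Local Open Scope classical_set_scope.
Local Open Scope ring_scope.

Section Geodesics.
Context {R : realType} {X : metricType R}.
Implicit Types (x y z p q : X) (c : R -> X).

(* Geodesic segments and rays are functions on all of [R]; their values outside
   [0, mdist x y], resp. [0, +oo[, are irrelevant. *)
Definition geodesic x y c :=
  [/\ c 0 = x, c (mdist x y) = y &
      forall s t, 0 <= s <= mdist x y -> 0 <= t <= mdist x y ->
        mdist (c s) (c t) = `|s - t|].

Definition geodesic_ray c :=
  forall s t, 0 <= s -> 0 <= t -> mdist (c s) (c t) = `|s - t|.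

Definition geodesic_line c := forall s t, mdist (c s) (c t) = `|s - t|.

Definition geodesic_triangle x y z c1 c2 c3 :=
  [/\ geodesic x y c1, geodesic y z c2 & geodesic z x c3].

Definition on_side x y c p := exists2 t, 0 <= t <= mdist x y & p = c t.

(* The norm of ['rV[R]_2] in the library is the sup norm, hence this explicit
   Euclidean distance on the model plane. *)
Definition euclid_dist (u v : 'rV[R]_2) : R :=
  Num.sqrt (\sum_i (u 0 i - v 0 i) ^+ 2).

Definition comparison_triangle x y z (x' y' z' : 'rV[R]_2) :=
  [/\ euclid_dist x' y' = mdist x y, euclid_dist y' z' = mdist y z &
      euclid_dist z' x' = mdist z x].

Definition side_comparison_point x y c p (x' y' p' : 'rV[R]_2) :=
  [/\ on_side x y c p,
      exists2 s : R, 0 <= s <= 1 & p' = (1 - s) *: x' + s *: y' &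
      euclid_dist x' p' = mdist x p].

Definition comparison_point x y z c1 c2 c3 p (x' y' z' p' : 'rV[R]_2) :=
  [\/ side_comparison_point x y c1 p x' y' p',
      side_comparison_point y z c2 p y' z' p' |
      side_comparison_point z x c3 p z' x' p'].

End Geodesics.

Section Spaces.
Context {R : realType} (X : metricType R).

Definition geodesic_space := forall x y : X, exists c, geodesic x y c.

(* This is [cauchy_cvg] of [completeType], which cannot be used here since it
   requires a pointed space. *)
Definition complete_space :=
  forall F : set_system X, ProperFilter F -> cauchy F -> exists x : X, F --> x.

Definition CAT0 :=
  forall (x y z : X) c1 c2 c3, geodesic_triangle x y z c1 c2 c3 ->
  forall x' y' z', comparison_triangle x y z x' y' z' ->
  forall p q p' q',
    comparison_point x y z c1 c2 c3 p x' y' z' p' ->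
    comparison_point x y z c1 c2 c3 q x' y' z' q' ->
    mdist p q <= euclid_dist p' q'.

Definition proper_space :=
  forall (x : X) (r : R), compact [set y | mdist x y <= r].

(* Stating the condition for the first side is enough, as the vertices may be
   permuted cyclically. *)
Definition thin_triangles (delta : R) :=
  forall (x y z : X) c1 c2 c3, geodesic_triangle x y z c1 c2 c3 ->
  forall p, on_side x y c1 p ->
  exists2 q, on_side y z c2 q \/ on_side z x c3 q & mdist p q <= delta.

Definition hyperbolic_space := exists2 delta : R, 0 <= delta & thin_triangles delta.

End Spaces.

(* The two cases in the definition of an NPC space. A space may belong to both;
   the notions of convergence to a boundary point and of hyperbolic isometry are
   those of the case under consideration. *)
Variant npc_case := complete_CAT0_case | proper_hyperbolic_case.

Definition npc_space (k : npc_case) {R : realType} (X : metricType R) :=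
  geodesic_space X /\
  match k with
  | complete_CAT0_case => complete_space X /\ CAT0 X
  | proper_hyperbolic_case => proper_space X /\ hyperbolic_space X
  end.

Section Boundary.
Context {R : realType} {X : metricType R}.

Definition asymptotic (c1 c2 : R -> X) :=
  exists C : R, forall t, 0 <= t -> mdist (c1 t) (c2 t) <= C.

(* A boundary point is an equivalence class, i.e. a set of rays. *)
Definition boundary : set (set (R -> X)) :=
  [set xi | exists2 c, geodesic_ray c &
            xi = [set c' | geodesic_ray c' /\ asymptotic c c']].

(* Convergence in the cone topology: for a ray [c] in the class [xi], the
   basic neighbourhoods of [xi] in [X] are the sets of those [x] at distance
   greater than [r] from [c 0] such that the point at distance [r] from [c 0]
   on the geodesic from [c 0] to [x] is at distance less than [e] from [c r]. *)
Definition cone_cvg (x_ : nat -> X) (xi : set (R -> X)) :=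
  forall c, xi c -> forall r e : R, 0 < r -> 0 < e ->
  \forall n \near \oo, r < mdist (c 0) (x_ n) /\
    forall s, geodesic (c 0) (x_ n) s -> mdist (s r) (c r) < e.

Definition gromov_product (p x y : X) : R :=
  (mdist p x + mdist p y - mdist x y) / 2.

Definition gromov_cvg (x_ : nat -> X) (xi : set (R -> X)) :=
  forall c, xi c -> forall (p : X) (M : R),
  \forall n \near \oo & t \near +oo, M <= gromov_product p (x_ n) (c t).

Definition boundary_cvg (k : npc_case) :=
  match k with
  | complete_CAT0_case => cone_cvg
  | proper_hyperbolic_case => gromov_cvg
  end.

End Boundary.

HB.mixin Record Group_isTopologicalGroup G & Topological G & Group G := {
  mulg_continuous : continuous (fun x : G * G => (x.1 * x.2)%g) ;
  invg_continuous : continuous (fun x : G => x^-1%g)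
}.

#[short(type="topologicalGroupType")]
HB.structure Definition TopologicalGroup :=
  {G of Topological G & Group G & Group_isTopologicalGroup G}.

Definition tdlc (G : topologicalGroupType) :=
  [/\ hausdorff_space G, totally_disconnected [set: G] &
      locally_compact [set: G]].

Section Scale.
Context {G : topologicalGroupType}.
Implicit Types (g : G) (U H K : set G).

Definition subgroup U :=
  [/\ U 1%g, forall x y, U x -> U y -> U (x * y)%g & forall x, U x -> U x^-1%g].

Definition compact_open_subgroup U := [/\ subgroup U, compact U & open U].

Definition conj_set g U : set G := [set (g * u * g^-1)%g | u in U].

Definition left_cosets H K : set (set G) :=
  [set [set (h * k)%g | k in K] | h in H].

Definition has_index H K (n : nat) := (left_cosets H K #= `I_n)%card.

Definition scale_values g : set nat :=
  [set n | exists2 U, compact_open_subgroup U &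
           has_index (conj_set g U) (U `&` conj_set g U) n].

(* The minimum of [scale_values g]; it would be 0, which is not an index, if
   there were no compact open subgroup. *)
Definition scale g : nat :=
  xget 0%N [set n | scale_values g n /\
                    forall m, scale_values g m -> (n <= m)%N].

Definition expgz g (n : int) : G :=
  match n with Posz m => (g ^+ m)%g | Negz m => (g ^- m.+1)%g end.

End Scale.

Section Actions.
Context {R : realType} {X : metricType R} {G : topologicalGroupType}.
Variable act : G -> X -> X.
Implicit Types (g h : G) (xi : set (R -> X)).

Definition isometric_action :=
  [/\ forall x, act 1%g x = x,
      forall g h x, act (g * h)%g x = act g (act h x) &
      forall g x y, mdist (act g x) (act g y) = mdist x y].

Definition continuous_action := continuous (fun z : G * X => act z.1 z.2).

Definition proper_action :=
  forall (x : X) (r : R), 0 < r ->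
    compact (closure [set g | mdist (act g x) x <= r]).

Definition boundary_act g xi : set (R -> X) := [set act g \o c | c in xi].

Definition boundary_stab xi : set G := [set g | boundary_act g xi = xi].

Definition has_axis g :=
  exists c : R -> X, geodesic_line c /\
  exists2 k : R, 0 < k & forall t, act g (c t) = c (t + k).

Definition qi_embedded_orbit g (x : X) :=
  exists L A : R, [/\ 1 <= L, 0 <= A &
    forall m n : int,
      `|m - n|%:~R / L - A <= mdist (act (expgz g m) x) (act (expgz g n) x)
        <= L * `|m - n|%:~R + A].

Variable k : npc_case.

Definition hyperbolic g :=
  match k with
  | complete_CAT0_case => has_axis g
  | proper_hyperbolic_case => exists x, qi_embedded_orbit g x
  end.

Definition attracting_point g xi :=
  boundary xi /\ forall x, boundary_cvg k (fun n => act (g ^+ n)%g x) xi.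

Definition repelling_point g xi := attracting_point g^-1%g xi.

Definition hyp_boundary : set (set (R -> X)) :=
  [set xi | exists2 g, hyperbolic g & attracting_point g xi \/ repelling_point g xi].

Definition hyp_arrow xi1 xi2 :=
  forall h, hyperbolic h -> attracting_point h xi1 -> repelling_point h xi2.

Definition hyp_attracted_to xi : set G :=
  [set g | hyperbolic g /\ attracting_point g xi].

End Actions.

(* Main.v *)
(* The scale of g is 1 if and only if g U g^-1 is contained in U for some compact
   open subgroup U. Let g be hyperbolic with attracting point xi and repelling
   point xi'. By properness of the action, x fixes xi if and only if the
   conjugates g^-n x g^n, n >= 0, stay in a compact set, and likewise for xi' with
   g^-1 in place of g; moreover the compact set only depends on the displacement
   of a base point by x, since asymptotic rays stay at a distance bounded in terms
   of the distance of their origins.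
   If V is a compact open subgroup such that the forward orbits under conjugation
   by g of the points of V with backward orbit in V are uniformly bounded, then
   some compact open subgroup U is mapped into itself. This applies to g^-1 as
   soon as the stabilizer of xi is open, and to g as soon as the stabilizer of xi
   fixes xi', which holds if xi -> xi'.
   Conversely, g^-1 U g <= U forces U to fix xi. If g U g^-1 <= U then, by
   recurrence modulo U of the conjugates g^-n x g^n of an x fixing xi, x fixes xi'
   as well; for x = h hyperbolic with attracting point xi this implies that xi' is
   the repelling point of h. *)
Require Import Defs.
From mathcomp Require Import all_boot all_order all_algebra.
From mathcomp Require Import all_classical all_reals all_analysis.
From mathcomp Require Import lra ring zify.

Set Implicit Arguments.
Unset Strict Implicit.
Unset Printing Implicit Defensive.

Import Order.TTheory GRing.Theory Num.Theory.

Local Open Scope classical_set_scope.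
Local Open Scope ring_scope.

(** * Compact sets *)

Section CompactSets.
Context {T : topologicalType}.
Implicit Types (A B C K O : set T) (D : set_system T) (F : set_system T).

(** If no [C] works, the parts of [K] and [C] in common outside [O] generate a proper filter. Its
    cluster point in [K] lies in every closed [C], hence in the open set [O], which the filter
    avoids. *)
Lemma compact_directed K D O : compact K -> D !=set0 -> D `<=` closed ->
  setI_closed D -> open O -> K `&` \bigcap_(C in D) C `<=` O ->
  exists2 C, D C & K `&` C `<=` O.
Proof.
move=> Kco [C0 DC0] Dcl DI Oop KDO; apply: contrapT => noC.
have Fp : ProperFilter (filter_from D (fun C => K `&` C `\` O)).
  apply: filter_from_proper; last first.
    move=> C DC; apply: contrapT => /nonemptyPn; rewrite setD_eq0 => CO.
    by apply: noC; exists C.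
  apply: filter_from_filter; first by exists C0.
  move=> C1 C2 D1 D2; exists (C1 `&` C2); first exact: DI.
  by move=> x [[Kx [C1x C2x]] nOx].
have [|p [Kp clp]] := Kco _ Fp; first by exists C0 => // x [[]].
have Op : O p.
  apply: KDO; split => // C DC; apply: (Dcl _ DC) => V Vp.
  have [] := clp (K `&` C `\` O) V _ Vp; first by exists C.
  by move=> x [[[_ Cx] _] Vx]; exists x.
have [||x [[_ nOx] Ox]] := clp (K `&` C0 `\` O) O; first by exists C0.
- exact: open_nbhs_nbhs.
- exact: nOx.
Qed.

(** The near-covering form of compactness, along the filter of small members of [F], makes one [W]
    serve all points of [B]. Below, [F] consists of the neighbourhoods of a point, then of a compact
    set. *)
Lemma compact_separate F B : Filter F -> compact B ->
  (forall b, B b -> exists2 V, nbhs b V & F (~` V)) ->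
  exists2 W, F W & B `<=` (~` W)°.
Proof.
move=> FF /compact_near_coveringP Bco BF.
(* The powerset filter below requires [F] to be proper; otherwise [W] may be empty. *)
have [F0|nF0] := pselect (F set0).
  by exists set0 => // x _; rewrite setC0 interiorT.
have FP : ProperFilter F by [].
have [|W [WF _ [W0 W0W]] WB] := Bco _ (powerset_filter_from F)
    (fun W => (~` W)°) (powerset_filter_from_filter FP).
  move=> b /BF[V bV FV]; exists (V°, [set W | W `<=` ~` V]).
    split => /=; first by apply: open_nbhs_nbhs; split => //; exact: open_interior.
    apply/near_powerset_filter_fromP; first by move=> ? ?; exact: subset_trans.
    by exists (~` V).
  by move=> [x W] [/= Vx WV]; apply: filterS Vx => y Vy /WV.
by exists W0; [exact: WF|exact: WB].
Qed.

(** [compact_separate] is applied twice: to separate each point of [B] from [A], then [B] from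
    [A]. *)
Lemma compact_separate_set A B : hausdorff_space T -> compact A -> compact B ->
  A `&` B = set0 -> exists U, [/\ open U, A `<=` U & B `<=` (~` U)°].
Proof.
move=> hT Aco Bco AB.
have [|W WA BW] := @compact_separate (set_nbhs A) B _ Bco; last first.
  exists W°; split; [exact: open_interior|move=> x Ax; exact: WA|].
  move=> x /BW; apply: filterS => y; apply: contra_not; exact: interior_subset.
move=> b Bb; have [|V bV AV] := @compact_separate (nbhs b) A _ Aco; last first.
  by exists V => // x Ax; exact: AV.
move=> a Aa; have /eqP ab : a <> b.
  by move=> ab; suff : (A `&` B) b; [rewrite AB|split=> //; rewrite -ab].
move: hT; rewrite open_hausdorff => /(_ _ _ ab)[[U V] /= [aU bV] [Uo Vo /eqP UV]].
exists U; first by apply: open_nbhs_nbhs; split; last exact: set_mem aU.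
apply: (@filterS _ _ _ V) => [x Vx Ux|].
  by suff : (U `&` V) x by rewrite UV.
by apply: open_nbhs_nbhs; split; last exact: set_mem bV.
Qed.

(* The quasi-component of [x] in a compact set is connected. *)
Lemma totally_disconnected_clopen K x : hausdorff_space T ->
  totally_disconnected [set: T] -> compact K -> nbhs x K ->
  exists C, [/\ C x, C `<=` K, compact C & open C].
Proof.
move=> hT tdT Kco xK.
have Kcl := compact_closed hT Kco.
(* The relatively clopen subsets of [K] containing [x]; their intersection [Q] is the
   quasi-component. *)
pose D := [set C | [/\ C x, C `<=` K, closed C & closed (K `\` C)]].
have DI : setI_closed D.
  move=> C1 C2 [x1 s1 c1 d1] [x2 s2 c2 d2]; split => //.
  - by move=> y [/s1].
  - exact: closedI.
  - by rewrite setDIr; exact: closedU.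
have DK : D K.
  by split => //; [exact: nbhs_singleton|rewrite setDv; exact: closed0].
pose Q := \bigcap_(C in D) C.
have QK : Q `<=` K by move=> y /(_ K DK).
have Qcl : closed Q by apply: closed_bigI => C [].
have Qx : Q x by move=> C [].
have Qconn : connected Q.
  apply/connectedP => E [E0 QE [sE1 sE2]].
  have Ecl b : closed (E b).
    move=> y clEy; have : Q y.
      by apply: Qcl; apply: closureS clEy; rewrite QE; case: b; [right|left].
    rewrite QE => -[Ey|Ey]; case: b clEy => // clEy.
      by suff : (E false `&` closure (E true)) y by rewrite sE2.
    by suff : (closure (E false) `&` E true) y by rewrite sE1.
  have EK b : E b `<=` K.
    by apply: subset_trans QK; rewrite QE; case: b => y; [right|left].
  have Eco b : compact (E b) by exact: subclosed_compact (Ecl b) Kco (EK b).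
  have disj b : E b `&` E (~~ b) = set0.
    have := separated_disjoint (conj sE1 sE2).
    by case: b => //=; rewrite setIC.
  have [b Ebx] : exists b, E b x.
    by have := Qx; rewrite QE => -[]; [exists false|exists true].
  have [U [Uo EU EnU]] := compact_separate_set hT (Eco b) (Eco (~~ b)) (disj b).
  pose V := (~` U)°; have Vo : open V by exact: open_interior.
  have VU : V `<=` ~` U by exact: interior_subset.
  have [|||C [Cx CK Ccl KCcl] CUV] :=
      @compact_directed K D (U `|` V) Kco _ _ DI (openU Uo Vo).
  - by exists K.
  - by move=> C [].
  - move=> y [_ Qy]; have : Q y by [].
    rewrite QE; case: (b) EU EnU => EU EnU [] Ey;
      by [left; exact: EU|right; exact: EnU].
  (* Removing [V] from [C] leaves a member of [D], which thus contains [Q], although [V] contains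
     the nonempty piece [E (~~ b)] of [Q]. *)
  - have DCU : D (C `\` V).
      split.
      + by split => // /VU; apply; exact: EU.
      + by move=> y [/CK].
      + by apply: closedI => //; exact: open_closedC.
      + suff -> : K `\` (C `\` V) = (K `\` C) `|` (C `&` ~` U).
          by apply: closedU => //; apply: closedI => //; exact: open_closedC.
        apply/seteqP; split => y.
          move=> [Ky nCV]; have [Cy|nCy] := pselect (C y); last by left.
          right; split => //; apply: VU; apply: contrapT => nVy.
          by apply: nCV; split.
        move=> [[Ky nCy]|[Cy nUy]]; first by split => // -[].
        split => [|[_]]; first exact: CK.
        by apply; have [] := CUV y (conj (CK _ Cy) Cy).
    have [y Ey] := E0 (~~ b).
    have : Q y by rewrite QE; case: (b) Ey; [left|right].
    by move=> /(_ _ DCU)[_]; apply; exact: EnU.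
have Q1 : Q `<=` [set x].
  by rewrite -(tdT x)//; exact: connected_component_max.
(* As [Q] reduces to [x], some [C] in [D] lies in the interior of [K], and is therefore open in the
   whole space. *)
have [|||C [Cx CK Ccl KCcl] CO] :=
    @compact_directed K D K° Kco _ _ DI (@open_interior _ K).
- by exists K.
- by move=> C [].
- by move=> y [_ /Q1 ->].
exists C; split => //; first exact: subclosed_compact Ccl Kco CK.
suff -> : C = K° `&` ~` (K `\` C) by apply: openI; [exact: open_interior|exact: closed_openC].
apply/seteqP; split => [y Cy|y [Ky nKC]].
  by split; [apply: CO; split => //; exact: CK|move=> []].
by apply: contrapT => nCy; apply: nKC; split => //; exact: interior_subset Ky.
Qed.

End CompactSets.

(** * Topological groups, compact open subgroups and the scale *)

Section TopologicalGroups.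
Context {G : topologicalGroupType}.
Local Open Scope group_scope.
Implicit Types (a g h x y : G) (U V W H K L : set G).

Lemma mulgl_continuous a : continuous (fun x : G => a * x).
Proof.
move=> x; apply: (@continuous_comp _ _ _ (fun y => (a, y)) (fun z => z.1 * z.2)).
  by apply: cvg_pair; [exact: cvg_cst|exact: cvg_id].
exact: mulg_continuous.
Qed.

Lemma mulgr_continuous a : continuous (fun x : G => x * a).
Proof.
move=> x; apply: (@continuous_comp _ _ _ (fun y => (y, a)) (fun z => z.1 * z.2)).
  by apply: cvg_pair; [exact: cvg_id|exact: cvg_cst].
exact: mulg_continuous.
Qed.

Lemma conjg_continuous a : continuous (fun x : G => x ^ a).
Proof.
move=> x; apply: (@continuous_comp _ _ _ (fun y => y * a) (fun y => a^-1 * y)).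
  exact: mulgr_continuous.
exact: mulgl_continuous.
Qed.

Lemma conjg_continuous_pair : continuous (fun z : G * G => z.1 ^ z.2).
Proof.
move=> z; apply: (@continuous_comp _ _ _ (fun z => (z.2^-1, z.1 * z.2))
  (fun z => z.1 * z.2)); last exact: mulg_continuous.
apply: cvg_pair; last exact: mulg_continuous.
apply: (@continuous_comp _ _ _ snd (fun y : G => y^-1)); last exact: invg_continuous.
exact: cvg_snd.
Qed.

Lemma subgroup_open U : subgroup U -> nbhs 1 U -> open U.
Proof.
move=> [U1 UM UV] nU; rewrite openE => x Ux.
have : nbhs x ((fun y => x^-1 * y) @^-1` U).
  by apply: mulgl_continuous; rewrite mulVg.
by apply: filterS => y /= Uxy; rewrite -(mulVKg x y); exact: UM.
Qed.

Lemma subgroup_closed U : subgroup U -> nbhs 1 U -> closed U.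
Proof.
move=> [U1 UM UV] nU x clUx.
have : nbhs x ((fun y => x^-1 * y) @^-1` U).
  by apply: mulgl_continuous; rewrite mulVg.
move=> /clUx[y [Uy /= Uxy]].
by rewrite -(invgK x) -(mulgK y x^-1); apply/UV/UM => //; exact: UV.
Qed.

Lemma compact_open_subgroup_sub U K : subgroup U -> nbhs 1 U -> compact K ->
  U `<=` K -> compact_open_subgroup U.
Proof.
move=> Ug nU Kco UK; split => //; last exact: subgroup_open.
by apply: subclosed_compact Kco UK; exact: subgroup_closed.
Qed.

Lemma subgroupI U V : subgroup U -> subgroup V -> subgroup (U `&` V).
Proof.
move=> [U1 UM UV] [V1 VM VV]; split => // [x y [? ?] [? ?]|x [? ?]].
  by split; [exact: UM|exact: VM].
by split; [exact: UV|exact: VV].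
Qed.

(* Van Dantzig: the right stabilizer of a compact open neighbourhood of [1] is
   an open subgroup. *)
Lemma exists_compact_open_subgroup : tdlc G -> exists U, compact_open_subgroup U.
Proof.
move=> [hG tdG lcG].
have [K nK [Kco _]] : compact_near (within [set: G] (nbhs (1 : G))) by exact: lcG.
have {}nK : nbhs 1 K by move: nK; rewrite /within /=; apply: filterS => x; exact.
have [C [C1 CK Cco Cop]] := totally_disconnected_clopen hG tdG Kco nK.
pose U := [set x : G | forall c, C c -> C (c * x) /\ C (c * x^-1)].
have UC : U `<=` C by move=> x /(_ _ C1)[]; rewrite mul1g.
have Ug : subgroup U.
  split=> [c Cc|x y Ux Uy c Cc|x Ux c /Ux[]]; last by rewrite invgK.
    by rewrite invg1 mulg1.
  by rewrite invgM !mulgA; split; [apply Uy; apply Ux|apply Ux; apply Uy].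
have nC : nbhs 1 [set x : G | C `<=` (fun c => C (c * x))].
  move/compact_near_coveringP : Cco; apply => c Cc.
  apply: (mulg_continuous (c, 1)); rewrite /= mulg1.
  exact: open_nbhs_nbhs.
exists U; apply: compact_open_subgroup_sub Cco UC => //.
have nVC : nbhs 1 ((fun x : G => x^-1) @^-1` [set x : G | C `<=` (fun c => C (c * x))]).
  by apply: invg_continuous; rewrite invg1.
by apply: filterS2 nC nVC => x Cx CVx c Cc; split; [exact: Cx|exact: CVx].
Qed.

Lemma conjgVE x g : x ^ g^-1 = g * x * g^-1.
Proof. by rewrite conjgE invgK mulgA. Qed.

Lemma conj_setE g U : conj_set g U = [set x | U (x ^ g)].
Proof.
apply/seteqP; split => [x [u Uu <-]|x /= Ux].
  by rewrite /= -conjgVE conjgKV.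
by exists (x ^ g) => //; rewrite -conjgVE conjgK.
Qed.

Lemma compact_open_subgroup_conj g U : compact_open_subgroup U ->
  compact_open_subgroup (conj_set g U).
Proof.
move=> [[U1 UM UV] Uco Uop]; split; last first.
- rewrite conj_setE; apply: open_comp Uop => x _; exact: conjg_continuous.
- have -> : conj_set g U = (fun u => u ^ g^-1) @` U.
    by apply: eq_imagel => u _; rewrite conjgVE.
  apply: continuous_compact Uco; apply: continuous_subspaceT.
  exact: conjg_continuous.
- rewrite conj_setE; split=> [|x y|x] /=; rewrite ?conj1g ?conjMg ?conjVg //.
  + exact: UM.
  + exact: UV.
Qed.

Lemma left_coset_eq K x y : subgroup K -> K (x^-1 * y) ->
  [set x * k | k in K] = [set y * k | k in K].
Proof.
move=> [K1 KM KV] Kxy; apply/seteqP; split => _ [k Kk <-].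
  exists (y^-1 * x * k); last by rewrite !mulgA mulgV mul1g.
  by apply: KM => //; rewrite -(invgK x) -invgM; exact: KV.
exists (x^-1 * y * k); last by rewrite !mulgA mulgV mul1g.
exact: KM.
Qed.

(** The open cosets of [K] cover the compact [H]. The finite subcover is obtained as a near-covering
    along the filter [F] of large finite sets of cosets. *)
Lemma has_finite_index H K : compact H -> subgroup K -> open K ->
  exists n, has_index H K n.
Proof.
move=> Hco Kg Kop; apply/finite_setP.
pose F := filter_from [set D : set (set G) | finite_set D]
            (fun D => [set D' | finite_set D' /\ D `<=` D']).
have FF : Filter F.
  apply: filter_from_filter; first by exists set0; exact: finite_set0.
  move=> D1 D2 f1 f2; exists (D1 `|` D2); first by rewrite /= finite_setU.
  by move=> D [fD]; rewrite subUset => -[].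
have : \forall D \near F, H `<=` (fun x => D [set x * k | k in K]).
  move/compact_near_coveringP : Hco; apply => x Hx.
  exists ([set y | K (x^-1 * y)],
      [set D | finite_set D /\ [set [set x * k | k in K]] `<=` D]).
    split => /=; last first.
      by exists [set [set x * k | k in K]]; [exact: finite_set1|].
    have : nbhs x ((fun y => x^-1 * y) @^-1` K).
      apply: mulgl_continuous; rewrite mulVg; apply: open_nbhs_nbhs.
      by split => //; case: Kg.
    exact.
  move=> [y D] [/= Kxy [_ xD]]; rewrite -(left_coset_eq Kg Kxy); exact: xD.
move=> [D fD DH]; apply: (sub_finite_set _ fD) => _ [h Hh <-].
by apply: DH Hh; split.
Qed.

Lemma has_index_gt0 H K n : H !=set0 -> has_index H K n -> (0 < n)%N.
Proof.
move=> [h Hh]; case: n => // ; rewrite /has_index II0 card_eq0 => /eqP H0.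
suff : left_cosets H K [set h * k | k in K] by rewrite H0.
by exists h.
Qed.

Lemma has_index1 H K : subgroup H -> subgroup K -> K `<=` H ->
  has_index H K 1%N <-> H `<=` K.
Proof.
move=> [H1 HM HV] Kg KH; have [K1 KM KV] := Kg; split => [|HK].
  move=> /card_set_bijP[f [fH fi _]] h Hh.
  have lc x : H x -> left_cosets H K [set x * k | k in K] by move=> Hx; exists x.
  have : [set h * k | k in K] = [set 1 * k | k in K].
    apply: (fi _ _ (mem_set (lc h Hh)) (mem_set (lc 1 H1))).
    have I1 x : H x -> f [set x * k | k in K] = 0%N.
      by move=> Hx; have /= := fH _ (lc x Hx); rewrite ltnS leqn0 => /eqP.
    by rewrite !I1.
  by move=> /seteqP[+ _] => /(_ h) [|k Kk]; [exists 1; rewrite ?mulg1|rewrite mul1g => <-].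
rewrite /has_index -(card_eqr (card_set1 (x := K))).
have K1E : [set 1 * k | k in K] = K.
  apply/seteqP; split => [_ [k Kk <-]|k Kk]; first by rewrite mul1g.
  by exists k; rewrite ?mul1g.
suff -> : left_cosets H K = [set K] by exact: card_eqxx.
apply/seteqP; split => [_ [h Hh <-]|_ ->]; last by exists 1.
by rewrite /= -[RHS]K1E; apply/esym/left_coset_eq; rewrite // invg1 mul1g; exact: HK.
Qed.

Lemma scale_values_neq0 g : tdlc G -> scale_values g !=set0.
Proof.
move=> /exists_compact_open_subgroup[U Uco].
have [Vg Vc Vo] := compact_open_subgroup_conj g Uco; have [Ug _ Uo] := Uco.
have [n nU] := has_finite_index Vc (subgroupI Ug Vg) (openI Uo Vo).
by exists n, U.
Qed.

Lemma scale_valuesN0 g : ~ scale_values g 0%N.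
Proof.
move=> [U Uco] /has_index_gt0; rewrite ltnn => /(_ _)/notF; apply.
by have [[V1 _ _] _ _] := compact_open_subgroup_conj g Uco; exists 1.
Qed.

Lemma scale_values1 g :
  scale_values g 1%N <-> exists2 U, compact_open_subgroup U & conj_set g U `<=` U.
Proof.
split=> -[U Uco UgU]; exists U => //;
  have [Ug _ _] := Uco; have [Vg _ _] := compact_open_subgroup_conj g Uco.
- move/(has_index1 Vg (subgroupI Ug Vg) (@subIsetr _ _ _)) : UgU.
  by move=> /subset_trans; apply; exact: subIsetl.
- apply/(has_index1 Vg (subgroupI Ug Vg) (@subIsetr _ _ _)).
  by rewrite subsetI; split.
Qed.

Lemma scale_min g : tdlc G ->
  scale_values g (scale g) /\ forall m, scale_values g m -> (scale g <= m)%N.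
Proof.
move=> /(scale_values_neq0 g)[n gn]; rewrite /scale.
apply: (@xgetPex _ 0%N [set n | scale_values g n /\
                    forall m, scale_values g m -> (n <= m)%N]).
have ex : exists n, `[< scale_values g n >] by exists n; exact/asboolP.
case: (ex_minnP ex) => m /asboolP gm mmin; exists m; split => // p gp.
by apply: mmin; exact/asboolP.
Qed.

Lemma scale_eq1 g U : tdlc G -> compact_open_subgroup U ->
  (forall u, U u -> U (u ^ g^-1)) -> scale g = 1%N.
Proof.
move=> tG Uco UgU; have [gs smin] := scale_min g tG.
have /smin : scale_values g 1%N.
  apply/scale_values1; exists U => // _ [u Uu <-].
  by rewrite -conjgVE; exact: UgU.
by case: (scale g) gs => [/scale_valuesN0//|[]].
Qed.

Lemma scale_gt1 g : tdlc G ->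
  (forall U, compact_open_subgroup U ->
     (forall u, U u -> U (u ^ g^-1)) -> False) -> (1 < scale g)%N.
Proof.
move=> tG noU; have [gs _] := scale_min g tG.
case: (scale g) gs => [/scale_valuesN0//|[|//]].
move=> /scale_values1[U Uco UgU]; case: (noU U Uco) => u Uu.
by rewrite conjgVE; apply: UgU; exists u.
Qed.

(* [L] is the increasing union of the conjugates of the compact group of all [x]
   whose backward orbit stays in [V]; replacing [V] by its [L]-invariant core [W],
   a long enough partial intersection of the conjugates of [W], times [L], is
   mapped into itself. *)
Lemma exists_conj_invariant a V K :
  compact_open_subgroup V -> compact K ->
  (forall x, (forall i, V (x ^ a^-1 ^+ i)) -> forall n, K (x ^ a ^+ n)) ->
  exists2 U, compact_open_subgroup U & forall u, U u -> U (u ^ a).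
Proof.
move=> [[V1 VM VV] Vco Vop] Kco VK.
pose P := [set x | forall i, V (x ^ a^-1 ^+ i)].
have aK x : (x ^ a) ^ a^-1 = x by exact: conjgK.
have akK n x : (x ^ a^-1 ^+ n) ^ a ^+ n = x by rewrite expVgn conjgKV.
have PS x : P x -> P (x ^ a^-1) by move=> Px i; rewrite -conjgM -expgS; exact: Px.
have PM x y : P x -> P y -> P (x * y).
  by move=> Px Py i; rewrite conjMg; exact: VM.
have PV x : P x -> P x^-1 by move=> Px i; rewrite conjVg; exact: VV.
have P1 : P 1 by move=> i; rewrite conj1g.
pose L := [set x | exists n, P (x ^ a^-1 ^+ n)].
have Ple x m n : (m <= n)%N -> P (x ^ a^-1 ^+ m) -> P (x ^ a^-1 ^+ n).
  move=> /subnK <- Px; elim: (n - m)%N => // k IHk.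
  by rewrite addSn expgSr conjgM; exact: PS.
have L1 : L 1 by exists 0%N; rewrite conj1g.
have LM x y : L x -> L y -> L (x * y).
  move=> [m Px] [n Py]; exists (maxn m n); rewrite conjMg.
  by apply: PM; [apply: Ple Px; exact: leq_maxl|apply: Ple Py; exact: leq_maxr].
have LV x : L x -> L x^-1 by move=> [n Px]; exists n; rewrite conjVg; exact: PV.
have La x : L x -> L (x ^ a).
  by move=> [n Px]; exists n.+1; rewrite expgS conjgM aK.
have LaV x : L x -> L (x ^ a^-1).
  by move=> [n Px]; exists n; rewrite -conjgM -expgS expgSr conjgM; exact: PS.
have LaVn n x : L x -> L (x ^ a^-1 ^+ n).
  by elim: n => [|n IHn] Lx; rewrite ?conjg1 // expgSr conjgM; exact/LaV/IHn.
(* A point of [L] lies on the forward orbit of a point of [P], and these orbits stay in [K]. *)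
have LK : L `<=` K by move=> x [n Px]; rewrite -(akK n x); exact: VK.
pose W := [set x | forall l, L l -> V (x ^ l)].
have Wg : subgroup W.
  split=> [l _|x y Wx Wy l Ll|x Wx l Ll]; rewrite ?conj1g ?conjMg ?conjVg //.
    by apply: VM; [exact: Wx|exact: Wy].
  by apply: VV; exact: Wx.
have WV : W `<=` V by move=> x /(_ _ L1); rewrite conjg1.
(* Compactness of [K], which contains [L], keeps the core [W] a neighbourhood of 1. *)
have nW : nbhs 1 W.
  have : nbhs 1 [set x | K `<=` (fun k => V (x ^ k))].
    move/compact_near_coveringP : (Kco); apply => k Kk.
    have : nbhs (1, k) ((fun z : G * G => z.1 ^ z.2) @^-1` V).
      by apply: conjg_continuous_pair; rewrite /= conj1g; exact: open_nbhs_nbhs.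
    by move=> [[A B] /= [A1 Bk] AB]; exists (B, A) => // -[y x] [/= By Ax]; exact: (AB (x, y)).
  by apply: filterS => x xV l /LK; exact: xV.
have [W1 WM WVi] := Wg.
have Wco : compact_open_subgroup W by exact: compact_open_subgroup_sub Vco WV.
have WL x l : W x -> L l -> W (x ^ l).
  by move=> Wx Ll l' Ll'; rewrite -conjgM; apply: Wx; exact: LM.
pose Wn n := [set x | forall i, (i <= n)%N -> W (x ^ a^-1 ^+ i)].
have WnS n : Wn n.+1 = Wn n `&` [set x | W (x ^ a^-1 ^+ n.+1)].
  apply/seteqP; split => [x Wx|x [Wx Wx1] i].
    by split; [move=> i /leqW; exact: Wx|exact: Wx].
  by rewrite leq_eqVlt => /orP[/eqP ->//|]; exact: Wx.
have Wnn n : nbhs 1 (Wn n).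
  elim: n => [|n IHn].
    by apply: filterS nW => x Wx i; rewrite leqn0 => /eqP ->; rewrite conjg1.
  rewrite WnS; apply: filterI => //.
  by apply: conjg_continuous; rewrite conj1g.
have Wng n : subgroup (Wn n).
  split=> [i _|x y Wx Wy i ni|x Wx i ni]; rewrite ?conj1g ?conjMg ?conjVg //.
    by apply: WM; [exact: Wx|exact: Wy].
  by apply: WVi; exact: Wx.
have WnL n x l : Wn n x -> L l -> Wn n (x ^ l).
  by move=> Wx Ll i ni; rewrite conjJg; apply: WL; [exact: Wx|exact: LaVn].
(* An open set containing the intersection of all [Wn n], since each point of the intersection is
   its own [c]; compactness of [W] then puts some [Wn n] inside [O]. *)
pose O := [set x | exists2 c, (forall i, W (c ^ a^-1 ^+ i)) & W ((x * c^-1) ^ a)].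
have Oop : open O.
  rewrite openE => x [c Wc Wxc].
  have : nbhs x ((fun y => (y * c^-1) ^ a) @^-1` W).
    apply: (@continuous_comp _ _ _ (fun y => y * c^-1) (fun y => y ^ a)).
    - exact: mulgr_continuous.
    - exact: conjg_continuous.
    - by apply: open_nbhs_nbhs; split => //; case: Wco.
  by apply: filterS => y Wyc; exists c.
have [|||||_ [n _ <-] WnO] := @compact_directed _ W (range Wn) O _ _ _ _ Oop.
- by case: Wco.
- by exists (Wn 0%N), 0%N.
- by move=> _ [n _ <-]; exact: subgroup_closed.
- move=> _ _ [m _ <-] [n _ <-]; exists (maxn m n) => //.
  apply/seteqP; split => [x Wx|x [Wx Wx'] i].
    by split => i im; apply: Wx; rewrite leq_max im ?orbT.
  by rewrite leq_max => /orP[]; [exact: Wx|exact: Wx'].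
- move=> x [_ Wx]; exists x; last by rewrite mulgV conj1g.
  by move=> i; apply: (Wx (Wn i)) => //; exists i.
have WnW x : Wn n x -> W x by move=> /(_ 0%N (leq0n _)); rewrite conjg1.
have [Wn1 WnM WnVi] := Wng n.
exists [set x | exists w l, [/\ Wn n w, L l & x = w * l]]; last first.
  move=> _ [w [l [Ww Ll ->]]].
  have [c Wc Wwc] : O w by apply: WnO; split => //; exact: WnW.
  have Lc : L c by exists 0%N => i; rewrite conjg1; apply: WV; exact: Wc.
  (* The factor [c] of [w] is moved into [L]. The other factor, once conjugated by [a], satisfies
     condition 0 of [Wn n] by choice of [c], and condition i+1 because [w] and [c] satisfy condition
     i. *)
  exists ((w * c^-1) ^ a), ((c * l) ^ a); split.
  - case=> [|i] ni; first by rewrite conjg1.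
    rewrite expgS conjgM aK conjMg conjVg; apply: WM; last exact/WVi/Wc.
    by apply: Ww; exact: ltnW.
  - by apply: La; exact: LM.
  - by rewrite -conjMg mulgA mulgVK.
have sub : [set x | exists w l, [/\ Wn n w, L l & x = w * l]] `<=`
    [set z.1 * z.2 | z in W `*` K].
  by move=> _ [w [l [/WnW Ww /LK Kl ->]]]; exists (w, l).
apply: compact_open_subgroup_sub sub.
- split.
  + by exists 1, 1; rewrite mulg1.
  + move=> _ _ [w [l [Ww Ll ->]]] [w' [l' [Ww' Ll' ->]]].
    exists (w * w' ^ l^-1), (l * l'); split.
    * by apply: WnM => //; apply: WnL => //; exact: LV.
    * exact: LM.
    * by rewrite conjgVE !mulgA mulgVK.
  + move=> _ [w [l [Ww Ll ->]]]; exists (w^-1 ^ l), l^-1; split.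
    * by apply: WnL => //; exact: WnVi.
    * exact: LV.
    * by rewrite invgM conjgE -!mulgA mulgV mulg1.
- apply: filterS (Wnn n) => w Ww; exists w, 1; split => //; by rewrite mulg1.
- apply: continuous_compact; last by apply: compact_setX => //; case: Wco.
  apply: continuous_subspaceT; exact: mulg_continuous.
Qed.

End TopologicalGroups.

(** * Geodesic rays and orbits *)

Section Rays.
Context {R : realType} {X : metricType R}.
Implicit Types (x y z o p q : X) (c : R -> X).

Lemma geodesic_ray_dist0 c t : geodesic_ray c -> 0 <= t -> mdist (c 0) (c t) = t.
Proof. by move=> rc t0; rewrite rc// sub0r normrN ger0_norm. Qed.

Lemma asymptotic_refl c : asymptotic c c.
Proof. by exists 0 => t _; rewrite mdistxx. Qed.

Lemma asymptotic_sym c1 c2 : asymptotic c1 c2 -> asymptotic c2 c1.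
Proof. by move=> [C cC]; exists C => t /cC; rewrite metric_sym. Qed.

Lemma asymptotic_trans c2 c1 c3 :
  asymptotic c1 c2 -> asymptotic c2 c3 -> asymptotic c1 c3.
Proof.
move=> [C cC] [D cD]; exists (C + D) => t t0.
have := metric_triangle (c1 t) (c2 t) (c3 t).
by have := cC t t0; have := cD t t0; lra.
Qed.

Definition ray_class c : set (R -> X) := [set c' | geodesic_ray c' /\ asymptotic c c'].

Lemma boundary_class xi c : boundary xi -> xi c -> xi = ray_class c.
Proof.
move=> [c0 rc0 ->] [rc c0c]; apply/seteqP; split => e [re c0e]; split => //.
  exact: asymptotic_trans (asymptotic_sym c0c) c0e.
exact: asymptotic_trans c0c c0e.
Qed.

Lemma boundary_ray xi c : boundary xi -> xi c -> geodesic_ray c.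
Proof. by move=> [c0 _ ->] []. Qed.

Lemma ray_class_boundary c : geodesic_ray c -> boundary (ray_class c).
Proof. by exists c. Qed.

Lemma ray_class_refl c : geodesic_ray c -> ray_class c c.
Proof. by split => //; exact: asymptotic_refl. Qed.

Lemma ray_class_eq c1 c2 : geodesic_ray c1 -> geodesic_ray c2 ->
  asymptotic c1 c2 <-> ray_class c1 = ray_class c2.
Proof.
move=> r1 r2; split => [c12|E].
  by apply: boundary_class; [exists c1|].
by have [] : ray_class c1 c2 by rewrite E; exact: ray_class_refl.
Qed.

End Rays.

(** * Rays tracked by the orbit of an isometry, and stabilizers of their classes *)

Section Tracking.
Context {R : realType} {X : metricType R} {G : topologicalGroupType}.
Variable act : G -> X -> X.
Hypothesis isomG : isometric_action act.
Local Open Scope group_scope.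
Local Open Scope ring_scope.
Implicit Types (g h x : G) (o : X) (c : R -> X).

Lemma act1 o : act 1%g o = o. Proof. by have [-> _ _] := isomG. Qed.

Lemma actM g h o : act (g * h)%g o = act g (act h o).
Proof. by have [_ -> _] := isomG. Qed.

Lemma actD g o p : mdist (act g o) (act g p) = mdist o p.
Proof. by have [_ _ ->] := isomG. Qed.

Lemma actVK g o : act g^-1%g (act g o) = o.
Proof. by rewrite -actM mulVg act1. Qed.

Lemma actKV g o : act g (act g^-1%g o) = o.
Proof. by rewrite -actM mulgV act1. Qed.

Lemma act_distl g o p : mdist (act g o) p = mdist o (act g^-1%g p).
Proof. by rewrite -{1}(actKV g p) actD. Qed.

(** Translates the size of the conjugates of [x] by powers of [g] into the displacement by [x] of
    the points of a [g]-orbit. *)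
Lemma act_conj_dist x h o p : mdist (act (x ^ h)%g o) p = mdist (act x (act h o)) (act h p).
Proof. by rewrite conjgE !actM act_distl invgK. Qed.

Lemma act_expgS g n o : act (g ^+ n.+1)%g o = act g (act (g ^+ n)%g o).
Proof. by rewrite expgS actM. Qed.

Lemma geodesic_ray_act g c : geodesic_ray c -> geodesic_ray (act g \o c).
Proof. by move=> rc s t s0 t0; rewrite /= actD rc. Qed.

Lemma asymptotic_act g c1 c2 :
  asymptotic c1 c2 -> asymptotic (act g \o c1) (act g \o c2).
Proof. by move=> [C cC]; exists C => t t0; rewrite /= actD cC. Qed.

Lemma boundary_act_class g c : boundary_act act g (ray_class c) = ray_class (act g \o c).
Proof.
apply/seteqP; split => [_ [e [re ce] <-]|e [re ce]].
  by split; [exact: geodesic_ray_act|exact: asymptotic_act].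
exists (act g^-1%g \o e); last by apply/funext => t /=; exact: actKV.
split; first exact: geodesic_ray_act.
have -> : c = act g^-1%g \o (act g \o c) by apply/funext => t /=; rewrite actVK.
exact: asymptotic_act.
Qed.

Lemma boundary_stab_class g c : geodesic_ray c ->
  boundary_stab act (ray_class c) g <-> asymptotic (act g \o c) c.
Proof.
move=> rc; rewrite /boundary_stab /= boundary_act_class ray_class_eq//.
exact: geodesic_ray_act.
Qed.

Lemma boundary_stab_subgroup xi : subgroup (boundary_stab act xi).
Proof.
have comp g h c : act (g * h)%g \o c = act g \o (act h \o c).
  by apply/funext => t /=; rewrite actM.
have actBM g h e : boundary_act act (g * h)%g e = boundary_act act g (boundary_act act h e).
  apply/seteqP; split => [_ [c ec <-]|_ [_ [c ec <-] <-]].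
    by exists (act h \o c); [exists c|rewrite comp].
  by exists c; rewrite ?comp.
have actB1 e : boundary_act act 1%g e = e.
  have id c : act 1%g \o c = c by apply/funext => t /=; rewrite act1.
  apply/seteqP; split => [_ [c ec <-]|c ec]; first by rewrite id.
  by exists c; rewrite ?id.
split=> [|g h|g]; rewrite /boundary_stab /=; first exact: actB1.
  by rewrite actBM => gx ->.
by move=> gx; rewrite -{1}gx -actBM mulVg.
Qed.

Definition escapes g := forall o (M : R),
  exists N, forall n, (N <= n)%N -> M <= mdist o (act (g ^+ n)%g o).

(* Being tracked by the orbit of a hyperbolic [g] characterizes, in both cases
   of the definition of NPC spaces, the rays in the class attracting [g]. *)
Definition tracks g c := exists C : R, forall n, exists2 t,
  0 <= t & mdist (act (g ^+ n)%g (c 0)) (c t) <= C.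

Lemma tracks_pt g c o : tracks g c -> exists C : R, forall n, exists2 t,
  0 <= t & mdist (act (g ^+ n)%g o) (c t) <= C.
Proof.
move=> [C cC]; exists (mdist o (c 0) + C) => n; have [t t0 tC] := cC n.
exists t => //; have := metric_triangle (act (g ^+ n)%g o) (act (g ^+ n)%g (c 0)) (c t).
by rewrite actD; lra.
Qed.

(** The times [T n] of the tracking points are unbounded and increase by bounded steps, so the first
    [T n] beyond [t] is close to [t]. *)
Lemma tracks_dense g c o : geodesic_ray c -> escapes g -> tracks g c ->
  exists C : R, forall t, 0 <= t -> exists n, mdist (act (g ^+ n)%g o) (c t) <= C.
Proof.
move=> rc eg /(tracks_pt o)[C cC].
pose T n := s2val (cid2 (cC n)).
have T0 n : 0 <= T n by rewrite /T; case: cid2.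
have TC n : mdist (act (g ^+ n)%g o) (c (T n)) <= C by rewrite /T; case: cid2.
(* A step of [T] is at most [2 * C + mdist o (act g o)], and the orbit point adds [C]; [T 0%N]
   covers the times before the first tracking point. *)
exists (3 * C + mdist o (act g o) + T 0%N) => t t0.
have C0 : 0 <= C by apply: le_trans (TC 0%N); exact: mdist_ge0.
have ex : exists n, t <= T n.
  have [N eN] := eg o (t + mdist o (c 0) + C); exists N.
  have := eN N (leqnn _); have := TC N.
  have := metric_triangle o (c 0) (c (T N)).
  have := metric_triangle o (c (T N)) (act (g ^+ N)%g o).
  by rewrite geodesic_ray_dist0// (metric_sym (c (T N)) (act _ _)); lra.
case: (ex_minnP ex) => n tn nmin; exists n.
have := metric_triangle (act (g ^+ n)%g o) (c (T n)) (c t).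
rewrite rc// ger0_norm ?subr_ge0//.
case: n tn nmin => [|n] tn nmin.
  have := TC 0%N; have := mdist_ge0 o (act g o); lra.
have tn' : T n < t by rewrite ltNge; apply/negP => /nmin; rewrite ltnn.
have : T n.+1 - T n <= mdist (c (T n.+1)) (c (T n)) by rewrite rc// ler_norm.
have := metric_triangle (c (T n.+1)) (act (g ^+ n.+1)%g o) (c (T n)).
have := metric_triangle (act (g ^+ n.+1)%g o) (act (g ^+ n)%g o) (c (T n)).
rewrite {2}expgSr actM actD (metric_sym (act g o)).
rewrite (metric_sym (c (T n.+1)) (act _ _)).
have := TC n; have := TC n.+1; have := T0 0%N; lra.
Qed.

(** The point [c1 t] is near an orbit point, hence near some [c2 s]; comparing distances to the
    origins bounds the difference of [s] and [t]. *)
Lemma tracks_asymptotic g c1 c2 : geodesic_ray c1 -> geodesic_ray c2 ->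
  escapes g -> tracks g c1 -> tracks g c2 -> asymptotic c1 c2.
Proof.
move=> r1 r2 eg g1 g2; have [C cC] := tracks_dense (c1 0) r1 eg g1.
have [D cD] := tracks_pt (c1 0) g2.
exists (2 * (C + D) + mdist (c1 0) (c2 0)) => t t0.
have [n nC] := cC t t0; have [s s0 sD] := cD n.
set p := act _ _ in nC sD.
have := metric_triangle (c1 t) (c2 s) (c2 t); rewrite r2//.
have := metric_triangle (c1 t) p (c2 s).
have := metric_triangle (c1 0) (c2 0) (c2 s).
have := metric_triangle (c1 0) (c2 s) (c1 t).
have := metric_triangle (c2 0) (c1 0) (c1 t).
have := metric_triangle (c2 0) (c1 t) (c2 s).
rewrite !geodesic_ray_dist0// (metric_sym (c2 0) (c1 0)) (metric_sym (c2 0) (c1 t)).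
rewrite (metric_sym (c1 t) p).
rewrite (metric_sym (c2 s) (c1 t)).
by have [] := ger0P (s - t); lra.
Qed.

Lemma asymptotic_tracks g c1 c2 : asymptotic c1 c2 -> tracks g c1 -> tracks g c2.
Proof.
move=> [B cB] /(tracks_pt (c2 0))[C cC]; exists (C + B) => n.
have [t t0 tC] := cC n; exists t => //.
by have := metric_triangle (act (g ^+ n)%g (c2 0)) (c1 t) (c2 t); have := cB t t0; lra.
Qed.

(** By [tracks_dense], bounded displacement along the orbit passes to the ray. *)
Lemma bounded_asymptotic g x c o : geodesic_ray c -> escapes g -> tracks g c ->
  (exists B : R, forall n, mdist (act x (act (g ^+ n)%g o)) (act (g ^+ n)%g o) <= B) ->
  asymptotic (act x \o c) c.
Proof.
move=> rc eg /(tracks_dense o rc eg)[C cC] [B cB]; exists (2 * C + B) => t /cC[n nC] /=.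
have := metric_triangle (act x (c t)) (act x (act (g ^+ n)%g o)) (c t).
have := metric_triangle (act x (act (g ^+ n)%g o)) (act (g ^+ n)%g o) (c t).
by rewrite actD (metric_sym (c t) (act (g ^+ n)%g o)); have := cB n; lra.
Qed.

(** As [g] commutes with its powers, it displaces all points of an orbit by the same amount. *)
Lemma tracks_stab g c : geodesic_ray c -> escapes g -> tracks g c ->
  asymptotic (act g \o c) c.
Proof.
move=> rc eg gc; apply: (bounded_asymptotic (o := c 0) rc eg gc).
exists (mdist (act g (c 0)) (c 0)) => n.
by rewrite -actM -expgS expgSr actM actD.
Qed.

Lemma tracks_conj x g c : tracks g c -> tracks (g ^ x^-1)%g (act x \o c).
Proof.
move=> [C cC]; exists C => n; have [t t0 tC] := cC n; exists t => //=.
by rewrite -conjXg conjgE invgK actM act_distl actVK actM actVK.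
Qed.

(** A form common to both kinds of spaces: convexity of a CAT(0) metric gives factor 1 and no
    constant, the four-point inequality gives factor 3 and a constant. *)
Definition asymptotic_bound (C : R) := forall c1 c2 : R -> X,
  geodesic_ray c1 -> geodesic_ray c2 -> asymptotic c1 c2 ->
  forall t, 0 <= t -> mdist (c1 t) (c2 t) <= 3 * mdist (c1 0) (c2 0) + C.

(** The order of quantifiers matters: [B] does not depend on [x], so that a bound on displacements
    over a compact set yields one compact set for all conjugates. *)
Lemma stab_bounded g c C o : asymptotic_bound C -> geodesic_ray c -> tracks g c ->
  exists B : R, forall x, asymptotic (act x \o c) c -> forall n,
    mdist (act x (act (g ^+ n)%g o)) (act (g ^+ n)%g o) <= 3 * mdist (act x o) o + B.
Proof.
move=> CP rc /(tracks_pt o)[D cD]; exists (2 * D + C + 6 * mdist o (c 0)) => x xc n.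
have [t t0 tD] := cD n.
have := CP _ _ (geodesic_ray_act x rc) rc xc t t0; rewrite /=.
have := metric_triangle (act x (act (g ^+ n)%g o)) (act x (c t)) (act (g ^+ n)%g o).
have := metric_triangle (act x (c t)) (c t) (act (g ^+ n)%g o).
have := metric_triangle (act x (c 0)) (act x o) (c 0).
have := metric_triangle (act x o) o (c 0).
by rewrite !actD (metric_sym (c t) (act (g ^+ n)%g o)) (metric_sym (c 0) o); lra.
Qed.

(* The ray [act (h^-n * g^m) \o c'], where [m] is such that [g^m] and [h^n] move
   the base point to nearby points, starts near [c' 0] and is asymptotic to [c'],
   hence stays close to [c']; and it passes near [h^-n (c' 0)]. *)
Lemma tracks_inverse g h c c' C : asymptotic_bound C ->
  geodesic_ray c -> geodesic_ray c' -> escapes g -> escapes g^-1%g ->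
  tracks g c -> tracks h c -> tracks g^-1%g c' -> asymptotic (act h \o c') c' ->
  tracks h^-1%g c'.
Proof.
move=> CP rc rc' eg egV gc hc gVc' hc'.
set o := c' 0.
have [D cD] := tracks_dense o rc eg gc.
have [E cE] := tracks_pt o hc.
have [F cF] := gVc'.
(* [E + D] bounds the distance between the origins of the moved ray and of [c'], and [F] the
   distance from the inverse orbit point to the moved ray. *)
exists (F + 3 * (E + D) + C) => n.
have [s s0 sE] := cE n; have [m mD] := cD s s0.
have [u u0 uF] := cF m; exists u => //.
have fix_exp k e : asymptotic (act k \o c') c' -> asymptotic (act (k ^+ e)%g \o c') c'.
  move=> kc; elim: e => [|e IHe]; first by exists 0 => t _; rewrite /= expg0 act1 mdistxx.
  apply: asymptotic_trans kc.
  have -> : act (k ^+ e.+1)%g \o c' = act k \o (act (k ^+ e)%g \o c').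
    by apply/funext => t /=; rewrite act_expgS.
  exact: asymptotic_act.
have fixV k : asymptotic (act k \o c') c' -> asymptotic (act k^-1%g \o c') c'.
  move=> /(asymptotic_act k^-1%g)/asymptotic_sym.
  by have -> : act k^-1%g \o (act k \o c') = c'; [apply/funext => t /=; rewrite actVK|].
have gc' : asymptotic (act g \o c') c'.
  by rewrite -(invgK g); apply: fixV; exact: tracks_stab.
have hgc' : asymptotic (act (h ^- n)%g \o (act (g ^+ m)%g \o c')) c'.
  apply: (@asymptotic_trans _ _ (act (h ^- n)%g \o c')).
    by apply: asymptotic_act; exact: fix_exp.
  by apply/fixV/fix_exp.
have := CP _ _ _ rc' hgc' u u0.
move/(_ (geodesic_ray_act _ (geodesic_ray_act _ rc'))) => /=; rewrite -/o.
have : mdist (act (h ^- n)%g (act (g ^+ m)%g o)) o <= E + D.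
  rewrite act_distl invgK.
  have := metric_triangle (act (g ^+ m)%g o) (c s) (act (h ^+ n)%g o).
  by rewrite (metric_sym (c s) (act (h ^+ n)%g o)); lra.
have : mdist o (act (g ^+ m)%g (c' u)) <= F.
  by move: uF; rewrite expVgn act_distl invgK.
rewrite expVgn -(actD (h ^- n)%g o).
have := metric_triangle (act (h ^- n)%g o) (act (h ^- n)%g (act (g ^+ m)%g (c' u))) (c' u).
lra.
Qed.

End Tracking.

(** * Gromov hyperbolic spaces *)

Section GromovProduct.
Context {R : realType} {X : metricType R}.
Implicit Types (x y z o p q w : X) (c : R -> X) (D : R).
Local Notation gp := gromov_product.

Lemma gromov_product_sym w x y : gp w x y = gp w y x.
Proof. by rewrite /gromov_product (metric_sym x y) [mdist w x + _]addrC. Qed.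

(* Gromov's inequality (x|z) >= min((x|y), (y|z)) - D. *)
Definition four_point D := forall w x y z,
  gp w x y <= gp w x z + D \/ gp w y z <= gp w x z + D.

Lemma on_side_dist x y c p : geodesic x y c -> on_side x y c p ->
  mdist x p + mdist p y = mdist x y.
Proof.
move=> [c0 c1 cd] [t /andP[t0 t1] ->].
have l0 := mdist_ge0 x y.
have := cd 0 t; rewrite c0 lexx l0 t0 t1 sub0r normrN ger0_norm// => -> //.
have := cd t (mdist x y); rewrite c1 lexx l0 t0 t1 distrC ger0_norm ?subr_ge0//.
by move=> -> //; lra.
Qed.

Lemma gromov_product_le_side x y c p w : geodesic x y c -> on_side x y c p ->
  gp w x y <= mdist w p.
Proof.
move=> gc /(on_side_dist gc); rewrite /gromov_product.
have := metric_triangle w p x; have := metric_triangle w p y.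
by rewrite (metric_sym p x); lra.
Qed.

(* Walking along [x, y] by steps of length at most 1, one finds a place where the
   nearest of the other two sides changes. *)
Lemma gromov_product_ge_side (delta : R) w x y c : geodesic_space X ->
  0 <= delta -> thin_triangles X delta -> geodesic x y c ->
  exists2 p, on_side x y c p & mdist w p <= gp w x y + 2 * delta + 1.
Proof.
move=> gX d0 dX gc; have [c0 c1 cd] := gc.
have [e ge] := gX y w; have [f gf] := gX w x.
have l0 := mdist_ge0 x y.
pose T n : R := Num.min n%:R (mdist x y).
have T_itv n : 0 <= T n <= mdist x y by rewrite /T le_min ler0n l0 ge_min lexx orbT.
pose P n := `[< exists2 q, on_side w x f q & mdist (c (T n)) q <= delta >].
have P0 : P 0%N.
  apply/asboolP; exists x; last by rewrite /T /= min_l// c0 mdistxx.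
  by exists (mdist w x); [rewrite mdist_ge0 lexx|have [_ -> _] := gf].
(* At the first index satisfying [Q], the preceding point is near the side from [w] to [x], and the
   current one is near the side from [y] to [w], by thinness or because it is [y]. *)
pose Q n := ~~ P n || (mdist x y <= n%:R).
have exQ : exists n, Q n.
  exists (Num.truncn (mdist x y)).+1; apply/orP; right; apply: ltW.
  by rewrite truncnS_gt.
case: (ex_minnP exQ) => n Qn nmin.
have /asboolP[q wq qd] : P n.-1.
  case: n Qn nmin => [//|n] Qn nmin /=; apply: contraT => nP.
  by have := nmin n; rewrite /Q nP ltnn => /(_ isT).
have [r yr rd] : exists2 r, on_side y w e r & mdist (c (T n)) r <= delta.
  have [Pn|nP] := boolP (P n).
    exists y; last first.
      have -> : T n = mdist x y by move: Qn; rewrite /Q Pn /= /T => /min_r.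
      by rewrite c1 mdistxx.
    by exists 0; [rewrite lexx mdist_ge0|have [-> _ _] := ge].
  have [|r [//|fr] rd] := dX x y w c e f (And3 gc ge gf) (c (T n)); last first.
    by case/negP: nP; apply/asboolP; exists r.
  - by exists r.
  by exists (T n).
have TT : mdist (c (T n.-1)) (c (T n)) <= 1.
  rewrite cd//; case: (n) => [|k] /=; first by rewrite subrr normr0.
  have : k%:R + 1 = k.+1%:R :> R by rewrite -natr1.
  rewrite /T; case: (leP k%:R); case: (leP k.+1%:R) => ? ? ?;
    rewrite ler_norml; lra.
have pc : on_side x y c (c (T n.-1)) by exists (T n.-1).
exists (c (T n.-1)) => //; rewrite /gromov_product.
have := on_side_dist gc pc; have := on_side_dist gf wq; have := on_side_dist ge yr.
move: (c (T n.-1)) (c (T n)) qd rd TT {pc} => p p' qd rd pp'.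
have := metric_triangle w q p; have := metric_triangle x q p.
have := metric_triangle w r p; have := metric_triangle y r p.
have := metric_triangle p p' r.
rewrite (metric_sym x q) (metric_sym q p) (metric_sym r p) (metric_sym w r).
by rewrite (metric_sym y p) (metric_sym w y) (metric_sym w x) (metric_sym x w); lra.
Qed.

(** A point on the side from [x] to [z] that nearly realizes their Gromov product is [delta]-close
    to another side, whose distance to [w] bounds the product of its endpoints. *)
Lemma thin_four_point (delta : R) : geodesic_space X -> 0 <= delta ->
  thin_triangles X delta -> four_point (3 * delta + 1).
Proof.
move=> gX d0 dX w x y z.
have [c gc] := gX x z; have [e ge] := gX z y; have [f gf] := gX y x.
have [p cp wp] := gromov_product_ge_side w gX d0 dX gc.
have [q [eq|fq] pq] := dX x z y c e f (And3 gc ge gf) p cp.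
  right; have := gromov_product_le_side w ge eq.
  by rewrite gromov_product_sym; have := metric_triangle w p q; lra.
left; have := gromov_product_le_side w gf fq.
by rewrite gromov_product_sym; have := metric_triangle w p q; lra.
Qed.

(** Two uses of the four-point inequality along the chain [c1 t], [c1 T], [c2 T], [c2 t], seen from
    [c1 0]: consecutive Gromov products are at least [t] minus the distance of the origins. *)
Lemma four_point_asymptotic D (c1 c2 : R -> X) : four_point D ->
  geodesic_ray c1 -> geodesic_ray c2 -> asymptotic c1 c2 ->
  forall t, 0 <= t -> mdist (c1 t) (c2 t) <= 3 * mdist (c1 0) (c2 0) + 4 * `|D|.
Proof.
move=> fD r1 r2 [B cB] t t0; set q := c1 0; set q' := c2 0.
(* So far out, the product of [c1 T] and [c2 T] exceeds [t] whatever [B] is, and [B] disappears from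
   the final bound. *)
pose T := t + (mdist q q' + `|B|).
have q0 := mdist_ge0 q q'; have B0 := normr_ge0 B; have BB := ler_norm B.
have DD := ler_norm D; have D0 := normr_ge0 D.
have tT : t <= T by rewrite /T; lra.
have T0 : 0 <= T by lra.
have := cB T T0.
have d1 : mdist (c1 t) (c1 T) = T - t by rewrite r1// distrC ger0_norm ?subr_ge0.
have d2 : mdist (c2 t) (c2 T) = T - t by rewrite r2// distrC ger0_norm ?subr_ge0.
have e1 : mdist q (c1 t) = t by exact: geodesic_ray_dist0.
have e2 : mdist q (c1 T) = T by exact: geodesic_ray_dist0.
have f1 : mdist q' (c2 t) = t by exact: geodesic_ray_dist0.
have f2 : mdist q' (c2 T) = T by exact: geodesic_ray_dist0.
have := metric_triangle q q' (c2 t); have := metric_triangle q' q (c2 T).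
have := metric_triangle q' q (c2 t).
have := fD q (c1 t) (c1 T) (c2 T).
have := fD q (c1 t) (c2 T) (c2 t).
rewrite /gromov_product (metric_sym q' q) (metric_sym (c2 T) (c2 t)) d1 d2 e1 e2 f1 f2.
by rewrite /T => -[] ? [] ?; lra.
Qed.

(** The four-point inequality through [c T]: seen from [c 0], both [p] and the point of [c] at the
    same distance have almost maximal Gromov product with [c T]. *)
Lemma four_point_near_geodesic D E c p (T : R) : four_point D ->
  (forall s t, 0 <= s <= T -> 0 <= t <= T -> mdist (c s) (c t) = `|s - t|) ->
  mdist (c 0) p <= T -> mdist (c 0) p <= gp (c 0) p (c T) + E ->
  mdist p (c (mdist (c 0) p)) <= 2 * `|E| + 2 * `|D|.
Proof.
move=> fD cd sT; set s := mdist (c 0) p in sT *.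
have s0 : 0 <= s by exact: mdist_ge0.
have T0 : 0 <= T by lra.
have : mdist (c 0) (c T) = T.
  by rewrite cd ?lexx ?T0// sub0r normrN ger0_norm.
have : mdist (c 0) (c s) = s.
  by rewrite cd ?lexx ?T0 ?s0 ?sT// sub0r normrN ger0_norm.
have : mdist (c T) (c s) = T - s.
  by rewrite cd ?lexx ?T0 ?s0 ?sT// ger0_norm ?subr_ge0.
have := fD (c 0) p (c T) (c s); rewrite /gromov_product -/s.
have := ler_norm E; have := normr_ge0 E; have := ler_norm D; have := normr_ge0 D.
by move=> ? ? ? ? [] ? ? ? ? ?; lra.
Qed.

End GromovProduct.

(** * Orbits of isometries with linear escape in spaces satisfying the four-point inequality *)

Section HyperbolicOrbits.
Context {R : realType} {X : metricType R} {G : topologicalGroupType}.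
Variable act : G -> X -> X.
Hypothesis isomG : isometric_action act.
Local Open Scope group_scope.
Local Open Scope ring_scope.
Implicit Types (g h x : G) (o : X) (c : R -> X).
Local Notation gp := gromov_product.

Let actM := actM isomG.
Let actD := actD isomG.
Let act1 := act1 isomG.

Lemma dist_orbit g o i j :
  mdist (act (g ^+ i)%g o) (act (g ^+ (i + j))%g o) = mdist o (act (g ^+ j)%g o).
Proof. by rewrite expgnDr actM actD. Qed.

Lemma dist_orbit_le g o n :
  mdist o (act (g ^+ n)%g o) <= n%:R * mdist o (act g o).
Proof.
elim: n => [|n IHn]; first by rewrite expg0 act1 mdistxx mul0r.
have := metric_triangle o (act (g ^+ n)%g o) (act (g ^+ n.+1)%g o).
by rewrite -(addn1 n) dist_orbit expg1 natrD mulrDl mul1r; lra.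
Qed.

(** The lower half of the quasi-isometry inequality for every base point; axial isometries satisfy
    it as well. *)
Definition linear_escape g := forall o, exists L A : R,
  0 < L /\ forall n, n%:R <= L * (mdist o (act (g ^+ n)%g o) + A).

Lemma qi_linear_escape g : (exists o, qi_embedded_orbit act g o) -> linear_escape g.
Proof.
move=> [x [L [A [L1 A0 LA]]]] o; exists L, (A + 2 * mdist o x); split; first by lra.
move=> n; have /andP[+ _] := LA n 0%:Z.
rewrite subr0 /= expg0 act1 => le1.
have L0 : 0 < L by lra.
have le2 : n%:R / L <= mdist o (act (g ^+ n)%g o) + (A + 2 * mdist o x).
  have := metric_triangle (act (g ^+ n)%g x) (act (g ^+ n)%g o) x.
  have := metric_triangle (act (g ^+ n)%g o) o x.
  rewrite actD (metric_sym x o) (metric_sym (act (g ^+ n)%g o) o).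
  by move: le1; lra.
by rewrite -ler_pdivrMl// mulrC.
Qed.

Lemma linear_escape_escapes g : linear_escape g -> escapes act g.
Proof.
move=> lg o M; have [L [A [L0 LA]]] := lg o.
exists (Num.truncn (L * (`|M| + `|A|))).+1 => n nN.
have : L * (`|M| + `|A|) <= n%:R.
  apply: (le_trans (ltW (truncnS_gt _))).
  by rewrite ler_nat.
move=> /le_trans/(_ (LA n)); rewrite ler_pM2l//.
by have := ler_norm M; have := ler_norm A; lra.
Qed.

(** Otherwise each doubling of the exponent would add at most [K], and the displacement by the power
    [2 ^ k] would grow linearly in [k] instead of exponentially. *)
Lemma exists_doubling_gap g o K : linear_escape g ->
  exists N, (0 < N)%N /\
    mdist o (act (g ^+ N)%g o) + K < mdist o (act (g ^+ (N + N))%g o).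
Proof.
move=> lg; have [L [A [L0 LA]]] := lg o.
pose a n := mdist o (act (g ^+ n)%g o).
apply: contrapT => noN.
have aS k : a (2 ^ k)%N <= a 1%N + k%:R * `|K|.
  elim: k => [|k IHk]; first by rewrite mul0r addr0.
  have : a (2 ^ k.+1)%N <= a (2 ^ k)%N + K.
    rewrite leNgt; apply/negP => aK; apply: noN; exists (2 ^ k)%N.
    by rewrite expn_gt0 addnn -mul2n -expnS.
  by rewrite -natr1 mulrDl mul1r; have := ler_norm K; lra.
pose B := L * (a 1%N + `|A| + 2 * `|K|).
have kB k : k.+1%:R * k.+1%:R <= B * k.+1%:R.
  have : k.+1%:R * k.+1%:R <= (2 ^ (k.+1 + k.+1))%:R :> R.
    by rewrite -natrM ler_nat expnD leq_mul// ltnW// ltn_expl.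
  move=> /le_trans; apply; apply: (le_trans (LA _)).
  rewrite /B -mulrA ler_pM2l//.
  have := aS (k.+1 + k.+1)%N; rewrite /a natrD.
  have := mdist_ge0 o (act (g ^+ 1)%g o).
  have : 1 <= k.+1%:R :> R by rewrite ler1n.
  have := ler_norm A; have := normr_ge0 A.
  move: (mdist _ _) (mdist _ _) (k.+1%:R : R) `|A| `|K| => u v w z t.
  nra.
have := kB (Num.truncn B); rewrite ler_pM2r ?ltr0n//.
by rewrite leNgt truncnS_gt.
Qed.

(* Local-to-global principle: the Gromov products are those of the points at
   positions [0], [i + j] seen from position [i], and it suffices to control
   them for [j = 1]. *)
Lemma orbit_almost_geodesic D g o : four_point (X := X) D -> 0 <= D ->
  linear_escape g -> exists N E, [/\ (0 < N)%N, 0 <= E & forall i j,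
    mdist o (act (g ^+ (N * i))%g o) + mdist o (act (g ^+ (N * j))%g o)
      <= mdist o (act (g ^+ (N * (i + j)))%g o) + E].
Proof.
move=> fD D0 /(exists_doubling_gap o (3 * D))[N [N0 gap]].
exists N; pose p i := act (g ^+ (N * i))%g o.
pose a i := mdist o (p i).
have dp i j k : (i + k = j)%N -> mdist (p i) (p j) = a k.
  by move=> <-; rewrite /p mulnDr dist_orbit.
have dp' i j k : (i + k = j)%N -> mdist (p j) (p i) = a k.
  by move=> /dp <-; rewrite metric_sym.
have p0 : p 0%N = o by rewrite /p muln0 expg0 act1.
have a0 : a 0%N = 0 by rewrite /a p0 mdistxx.
pose E := 2 * a 1%N - a 2%N.
have {}gap : a 1%N + 3 * D < a 2%N.
  by move: gap; rewrite /a /p muln1 muln2 addnn.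
have E0 : 0 <= E.
  by have := metric_triangle o (p 1%N) (p 2%N); rewrite -/(a 2%N) (dp 1%N 2%N 1%N)// /E /a; lra.
(* In the inductive step, the gap and the induction hypothesis exclude the first alternative of the
   four-point inequality; the second is the claim. *)
have E1 n : a n + a 1%N <= a n.+1 + E + 2 * D.
  elim: n => [|n IHn]; first by rewrite a0; lra.
  have := fD (p n.+1) (p n) (p 0%N) (p n.+2).
  rewrite /gromov_product (dp' n n.+1 1%N) ?addn1// (dp' 0%N n.+1 n.+1)//.
  rewrite (dp n.+1 n.+2 1%N) ?addn1// (dp' 0%N n n)// (dp n n.+2 2%N) ?addn2//.
  by rewrite (dp 0%N n.+2 n.+2)// => -[] ?; rewrite /E in IHn *; lra.
exists (E + 4 * D); split => //; first by lra.
suff aD i j : a i + a j <= a (i + j)%N + (E + 4 * D) by exact: aD.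
case: j => [|m]; first by rewrite addn0 a0; lra.
(* The first alternative is the claim, by [E1 i]; the second, with [E1 m], contradicts the gap, and
   here the full [3 * D] is used. *)
have := fD (p i) (p 0%N) (p (i + m.+1)%N) (p (i + 1)%N).
rewrite /gromov_product (dp' 0%N i i)// (dp i (i + m.+1)%N m.+1)//.
rewrite (dp i (i + 1)%N 1%N)// (dp 0%N (i + m.+1)%N (i + m.+1)%N)//.
rewrite (dp 0%N (i + 1)%N (i + 1)%N)// (dp' (i + 1)%N (i + m.+1)%N m); last by lia.
by have := E1 i; have := E1 m; rewrite /E addn1 => ? ? [] ?; lra.
Qed.

End HyperbolicOrbits.

(** * Tracked rays and Gromov convergence *)

Section HyperbolicRays.
Context {R : realType} {X : metricType R} {G : topologicalGroupType}.
Variable act : G -> X -> X.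
Hypothesis isomG : isometric_action act.
Local Open Scope group_scope.
Local Open Scope ring_scope.
Implicit Types (g h x : G) (o : X) (c : R -> X).
Local Notation gp := gromov_product.

Let actM := actM isomG.
Let actD := actD isomG.

Lemma dist_orbit_div g o N n : (0 < N)%N ->
  mdist (act (g ^+ n)%g o) (act (g ^+ (N * (n %/ N)))%g o) <= N%:R * mdist o (act g o).
Proof.
move=> N0; rewrite {1}(divn_eq n N) mulnC metric_sym dist_orbit//.
apply: (le_trans (dist_orbit_le isomG _ _ _)); apply: ler_wpM2r.
  exact: mdist_ge0.
by rewrite ler_nat ltnW// ltn_mod.
Qed.

(** A far orbit point has large Gromov product with [p i], the orbit being almost geodesic, and with
    the far points of [c], by convergence; hence [p i] is close to [c]. *)
Lemma gromov_cvg_tracks D g xi c : four_point (X := X) D -> 0 <= D ->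
  linear_escape act g -> geodesic_ray c -> xi c ->
  gromov_cvg (fun n => act (g ^+ n)%g (c 0)) xi -> tracks act g c.
Proof.
move=> fD D0 lg rc xc gxi; set o := c 0.
have [N [E [N0 E0 NE]]] := orbit_almost_geodesic isomG o fD D0 lg.
pose p i := act (g ^+ (N * i))%g o.
exists (N%:R * mdist o (act g o) + (2 * (E + D) + 2 * D)) => n.
pose i := (n %/ N)%N; exists (mdist o (p i)); first exact: mdist_ge0.
have := dist_orbit_div g o n N0; rewrite -/i -/(p i).
have [[A B] /= [[n0 _ n0A] [T [_ TB]]] AB] := gxi c xc o (mdist o (p i)).
(* Beyond the threshold [T] of the convergence, and far enough for [c] on [[0, t]] to reach the
   distance of [p i]. *)
pose t := Num.max (T + 1) (mdist o (p i)).
have tT : T < t by rewrite /t lt_max ltrDl ltr01.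
have ti : mdist o (p i) <= t by rewrite /t le_max lexx orbT.
have t0 : 0 <= t by apply: le_trans ti; exact: mdist_ge0.
have := AB ((N * (i + n0))%N, t) (conj (n0A _ _) (TB _ tT)) => /=.
move=> /(_ _)/wrap[|ge].
  by rewrite /= (leq_trans (leq_addl i n0))// leq_pmull.
have := @four_point_near_geodesic _ _ D (E + D) c (p i) t fD.
rewrite -/o ger0_norm ?addr_ge0// ger0_norm// => near.
suff : mdist (p i) (c (mdist o (p i))) <= 2 * (E + D) + 2 * D.
  by have := metric_triangle (act (g ^+ n)%g o) (p i) (c (mdist o (p i))); lra.
apply: near => // [s u /andP[s0 _] /andP[u0 _]|]; first exact: rc.
have := fD o (p i) (p (i + n0)%N) (c t).
have := NE i n0; rewrite -/(p i) -/(p n0) -/(p (i + n0)%N).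
move: ge; rewrite /gromov_product -/o -/(p (i + n0)%N).
have := dist_orbit isomG g o (N * i)%N (N * n0)%N.
rewrite -mulnDr -/(p i) -/(p n0) -/(p (i + n0)%N) => ->.
by move=> ? ? [] ?; lra.
Qed.

(** Orbit points are near points [e s] with [s] large, and the product of [e s] and [e t] seen from
    [e 0] is the smaller of [s] and [t]. *)
Lemma tracks_gromov_cvg g c o : geodesic_ray c -> escapes act g -> tracks act g c ->
  gromov_cvg (fun n => act (g ^+ n)%g o) (ray_class c).
Proof.
move=> rc eg gc e [re ce] p M.
have [C cC] := tracks_pt isomG o (asymptotic_tracks isomG ce gc).
pose K := M + C + mdist p (e 0).
have [N eN] := eg o (K + C + mdist o (e 0)).
exists ([set n | (N <= n)%N], [set t | `|K| < t]).
  by split; [exists N|exists `|K|; split; rewrite ?normr_real].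
move=> [n t] [/= /eN Nn Kt].
have KK := ler_norm K; have K0 := normr_ge0 K.
have [s s0 sC] := cC n.
have := metric_triangle o (e 0) (e s).
have := metric_triangle o (e s) (act (g ^+ n)%g o).
have := metric_triangle (e 0) p (act (g ^+ n)%g o).
have := metric_triangle (e 0) (act (g ^+ n)%g o) (e s).
have := metric_triangle (e 0) p (e t).
have := metric_triangle (act (g ^+ n)%g o) (e s) (e t).
rewrite /gromov_product (metric_sym (e s) (act _ _)) (metric_sym (e 0) p).
have t0 : 0 <= t by lra.
rewrite re// !geodesic_ray_dist0//.
by have [] := ger0P (s - t); rewrite /K in Nn Kt KK *; lra.
Qed.

(** Limits along one ultrafilter, valid for all times at once, replace the diagonal extraction of a
    subsequence. *)
Lemma ultrafilter_limit (U : set_system nat) (x_ : nat -> X) o (r : R) :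
  UltraFilter U -> proper_space X -> U [set n | mdist o (x_ n) <= r] ->
  exists p, forall e, 0 < e -> U [set n | mdist (x_ n) p < e].
Proof.
move=> UU pX Ur.
have [//|x [_ clx]] := @pX o r (x_ @ U) _.
exists x => e e0.
have [//|Un] := in_ultra_setVsetC [set n | mdist (x_ n) x < e] UU.
have [||y [/= nyx yx]] := clx (~` ball x e) (ball x e); last by [].
- suff : U (x_ @^-1` (~` ball x e)) by [].
  by apply: filterS Un => n; rewrite /= ballEmdist /= metric_sym.
- exact: nbhsx_ballx.
Qed.

(** The ray is a limit of geodesics from [o] to the points [p n]; each [p i] is close to those with
    [n] large, and so to the limit. *)
Lemma exists_tracked_ray_proper D g o : geodesic_space X -> proper_space X ->
  four_point (X := X) D -> 0 <= D -> linear_escape act g ->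
  exists2 c, geodesic_ray c & tracks act g c.
Proof.
move=> gX pX fD D0 lg.
have [N [E [N0 E0 NE]]] := orbit_almost_geodesic isomG o fD D0 lg.
pose p i := act (g ^+ (N * i))%g o.
pose a i := mdist o (p i).
pose s n := projT1 (cid (gX o (p n))).
have sP n : geodesic o (p n) (s n) := projT2 (cid (gX o (p n))).
have sd n u t : 0 <= u <= a n -> 0 <= t <= a n -> mdist (s n u) (s n t) = `|u - t|.
  by have [_ _ sn] := sP n; exact: sn.
have a0 n : 0 <= a n by exact: mdist_ge0.
have s0 n : s n 0 = o by have [] := sP n.
have sa n : s n (a n) = p n by have [] := sP n.
have osd n t : 0 <= t <= a n -> mdist o (s n t) = t.
  move=> /andP[t0 tn]; rewrite -{1}(s0 n) sd ?lexx ?t0 ?tn ?a0//.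
  by rewrite sub0r normrN ger0_norm.
have [U [UU eU]] := @ultraFilterLemma _ \oo _.
have Uinf t : U [set n | t <= a n].
  apply: eU; have [m em] := linear_escape_escapes lg o t.
  by exists m => // n /= mn; apply: em; rewrite (leq_trans mn)// leq_pmull.
(* The condition on [t] is put under the quantifier to make the choice of [q] total; the value at
   negative times is arbitrary. *)
have lim t : exists q, 0 <= t -> forall e, 0 < e -> U [set n | mdist (s n t) q < e].
  have [t0|_] := boolP (0 <= t); last by exists o.
  have [|x xP] := @ultrafilter_limit U (fun n => s n t) o t UU pX.
    by apply: filterS (Uinf t) => n /= tn; rewrite osd ?t0.
  by exists x.
pose c t := projT1 (cid (lim t)).
have cP t e : 0 <= t -> 0 < e -> U [set n | mdist (s n t) (c t) < e].
  by move=> t0; exact: (projT2 (cid (lim t)) t0).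
have c0 : c 0 = o.
  apply: mdist_positivity; apply/eqP; rewrite eq_le mdist_ge0 andbT.
  apply/ler_addgt0Pl => e e0; rewrite addr0.
  have /filter_ex[n /=] := cP 0 e (lexx 0) e0.
  by rewrite s0 metric_sym; exact: ltW.
have rc : geodesic_ray c.
  move=> u t u0 t0; apply/eqP; rewrite -subr_eq0 -normr_eq0 eq_le normr_ge0 andbT.
  apply/ler_addgt0Pl => e e0; rewrite addr0.
  have e2 : 0 < e / 2 by lra.
  have [n /= [[un tn] [uc tc]]] := filter_ex (filterI (filterI (Uinf u) (Uinf t))
    (filterI (cP u _ u0 e2) (cP t _ t0 e2))).
  have := sd n u t; rewrite u0 t0 un tn => /(_ isT isT).
  have := metric_triangle (s n u) (c u) (s n t).
  have := metric_triangle (c u) (c t) (s n t).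
  have := metric_triangle (c u) (s n u) (c t).
  have := metric_triangle (s n u) (s n t) (c t).
  rewrite (metric_sym (c t) (s n t)) (metric_sym (c u) (s n u)).
  by move: `|u - t| => z; rewrite ler_norml; lra.
exists c => //; exists (N%:R * mdist o (act g o) + (2 * (E + D) + 2 * D + 1)) => n.
rewrite c0; pose i := (n %/ N)%N; exists (a i) => //.
have := dist_orbit_div g o n N0; rewrite -/i -/(p i).
suff : mdist (p i) (c (a i)) <= 2 * (E + D) + 2 * D + 1.
  by have := metric_triangle (act (g ^+ n)%g o) (p i) (c (a i)); lra.
have /filter_ex[m /= [[im aim] cim]] : U ([set m | (i <= m)%N] `&`
    [set m | a i <= a m] `&` [set m | mdist (s m (a i)) (c (a i)) < 1]).
  apply: filterI; last exact: cP.
  by apply: filterI (Uinf _); apply: eU; exists i.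
suff : mdist (p i) (s m (a i)) <= 2 * (E + D) + 2 * D.
  by have := metric_triangle (p i) (s m (a i)) (c (a i)); lra.
have := @four_point_near_geodesic _ _ D (E + D) (s m) (p i) (a m) fD (sd m).
rewrite s0 ger0_norm ?addr_ge0// ger0_norm//; apply => //.
rewrite sa -/(a i) /gromov_product -/(a i) -/(a m).
have := NE i (m - i)%N; rewrite subnKC// -/(p _) -/(p _) -/(p _) -/(a _) -/(a _) -/(a _).
have := dist_orbit isomG g o (N * i)%N (N * (m - i))%N.
by rewrite -mulnDr subnKC// -/(p _) -/(p _) -/(p _) -/(a _) => ->; lra.
Qed.

End HyperbolicRays.

(** * CAT(0) spaces *)

Section CAT0Geometry.
Context {R : realType} {X : metricType R}.
Implicit Types (x y z p q : X) (c e : R -> X).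

Definition vec2 (a b : R) : 'rV[R]_2 := \row_i (if i == ord0 then a else b).

Lemma euclid_dist_vec2 a b a' b' :
  euclid_dist (vec2 a b) (vec2 a' b') = Num.sqrt ((a - a') ^+ 2 + (b - b') ^+ 2).
Proof. by rewrite /euclid_dist !big_ord_recl big_ord0 addr0 !mxE. Qed.

Lemma vec2_comb s t a b a' b' :
  s *: vec2 a b + t *: vec2 a' b' = vec2 (s * a + t * a') (s * b + t * b').
Proof. by apply/rowP => i; rewrite !mxE; case: ifP. Qed.

(** Stewart's theorem in a comparison triangle whose first side is put on the horizontal axis. *)
Lemma CAT0_median x y z c s : geodesic_space X -> CAT0 X -> geodesic x y c ->
  0 <= s <= 1 ->
  mdist z (c (s * mdist x y)) ^+ 2 <= (1 - s) * mdist z x ^+ 2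
    + s * mdist z y ^+ 2 - s * (1 - s) * mdist x y ^+ 2.
Proof.
move=> gX catX gc s01; have /andP[s0 s1] := s01; have [c0 c1 cd] := gc.
set l := mdist x y; set b := mdist z x; set a := mdist z y.
have l0 : 0 <= l by exact: mdist_ge0.
have a0 : 0 <= a by exact: mdist_ge0.
have b0 : 0 <= b by exact: mdist_ge0.
have [lE|lN] := eqVneq l 0.
  have xy : x = y by apply: mdist_positivity.
  by rewrite lE mulr0 c0 /a /b -xy -/b expr0n mulr0 subr0 -mulrDl subrK mul1r.
have {}lN : 0 < l by rewrite lt_neqAle eq_sym lN.
have [e ge] := gX y z; have [f gf] := gX z x.
have tri1 : a <= b + l by exact: metric_triangle.
have tri2 : b <= a + l by rewrite /l metric_sym; exact: metric_triangle.
have tri3 : l <= b + a by rewrite /b metric_sym; exact: metric_triangle.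
(* The abscissa of the third vertex, from the law of cosines; the triangle inequalities bound it by
   [b] in absolute value, so that the ordinate [v] exists. *)
pose u := (l ^+ 2 + b ^+ 2 - a ^+ 2) / (2 * l).
have ul : u * (2 * l) = l ^+ 2 + b ^+ 2 - a ^+ 2 by rewrite /u divfK//; apply: lt0r_neq0; lra.
have ub : u <= b by rewrite ler_pdivrMr; nra.
have ub' : - b <= u by rewrite ler_pdivlMr; nra.
have v0 : 0 <= b ^+ 2 - u ^+ 2 by nra.
pose v := Num.sqrt (b ^+ 2 - u ^+ 2).
have vE : v ^+ 2 = b ^+ 2 - u ^+ 2 by exact: sqr_sqrtr.
have sqE t w : 0 <= t -> w = t ^+ 2 -> Num.sqrt w = t.
  by move=> t0 ->; rewrite sqrtr_sqr ger0_norm.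
have sl : 0 <= s * l <= l by rewrite mulr_ge0//= ler_piMl.
have := catX x y z c e f (And3 gc ge gf) (vec2 0 0) (vec2 l 0) (vec2 u v).
move=> /(_ _ (c (s * l)) z (vec2 (s * l) 0) (vec2 u v)) cmp.
have {}cmp : mdist (c (s * l)) z <= euclid_dist (vec2 (s * l) 0) (vec2 u v).
  apply: cmp.
  - split; rewrite euclid_dist_vec2; apply: sqE => //; rewrite -/l ?(metric_sym y z) -/a -/b; nra.
  - constructor 1; split; first by exists (s * l).
    + by exists s => //; rewrite vec2_comb !mulr0 !add0r.
    + have -> : mdist x (c (s * l)) = s * l.
        rewrite -{1}c0 cd ?lexx ?l0// sub0r normrN ger0_norm//.
        by case/andP: sl.
      by rewrite euclid_dist_vec2; apply: sqE; [case/andP: sl|ring].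
  - constructor 3; split.
    + by exists 0; [rewrite lexx|have [-> _ _] := gf].
    + by exists 0; rewrite ?lexx ?ler01// subr0 scale1r scale0r addr0.
    + by rewrite mdistxx euclid_dist_vec2; apply: sqE => //; ring.
move: cmp; rewrite euclid_dist_vec2 metric_sym => cmp.
have d0 := mdist_ge0 z (c (s * l)).
have {cmp}: mdist z (c (s * l)) ^+ 2 <= (s * l - u) ^+ 2 + (0 - v) ^+ 2.
  rewrite -[leRHS]sqr_sqrtr; last by apply: addr_ge0; exact: sqr_ge0.
  by rewrite ler_sqr ?nnegrE// sqrtr_ge0.
move=> /le_trans; apply; rewrite sub0r sqrrN vE.
have -> : (s * l - u) ^+ 2 = (s * l) ^+ 2 - s * (u * (2 * l)) + u ^+ 2 by ring.
by rewrite ul le_eqVlt; apply/orP; left; apply/eqP; ring.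
Qed.

(** [CAT0_median] is applied from [q] to the first side, then from [x] to the second; all terms but
    the square of the right-hand side cancel. *)
Lemma CAT0_hinge z x y c e s : geodesic_space X -> CAT0 X ->
  geodesic z x c -> geodesic z y e -> 0 <= s <= 1 ->
  mdist (c (s * mdist z x)) (e (s * mdist z y)) <= s * mdist x y.
Proof.
move=> gX catX gc ge s01; have /andP[s0 s1] := s01; have [e0 _ ed] := ge.
set p := c _; set q := e _.
have qz : mdist q z = s * mdist z y.
  have l0 := mdist_ge0 z y.
  rewrite -{1}e0 metric_sym ed ?lexx ?l0//; last by rewrite mulr_ge0//= ler_piMl.
  by rewrite sub0r normrN ger0_norm// mulr_ge0.
have := CAT0_median q gX catX gc s01; rewrite -/p qz.
have := CAT0_median x gX catX ge s01; rewrite -/q (metric_sym x z) (metric_sym x q).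
rewrite (metric_sym q p) => h1 h2.
have D0 := mdist_ge0 x y; have d0 := mdist_ge0 p q.
rewrite -ler_sqr ?nnegrE ?mulr_ge0//; apply: (le_trans h2).
have := ler_wpM2l s0 h1.
have := sqr_ge0 (mdist z x).
lra.
Qed.

Lemma geodesic_rev x y c : geodesic x y c ->
  geodesic y x (fun t => c (mdist x y - t)).
Proof.
move=> [c0 c1 cd]; split; rewrite ?subr0 ?(metric_sym y x) ?subrr// => s t.
move=> /andP[s0 s1] /andP[t0 t1]; rewrite cd; last 2 first.
- by apply/andP; lra.
- by apply/andP; lra.
by rewrite -[RHS]normrN; congr (`|_|); ring.
Qed.

Lemma ray_geodesic c t : geodesic_ray c -> 0 <= t -> geodesic (c 0) (c t) c.
Proof.
move=> rc t0; split => //; rewrite geodesic_ray_dist0// => s u /andP[s0 _] /andP[u0 _].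
exact: rc.
Qed.

(** Convexity of the metric: the diagonal from [x] to [y'] cuts the quadrilateral into two
    hinges. *)
Lemma CAT0_quadrilateral x x' y y' c e s : geodesic_space X -> CAT0 X ->
  geodesic x y c -> geodesic x' y' e -> 0 <= s <= 1 ->
  mdist (c (s * mdist x y)) (e (s * mdist x' y'))
    <= (1 - s) * mdist x x' + s * mdist y y'.
Proof.
move=> gX catX gc ge s01; have [f gf] := gX x y'.
have s01' : 0 <= 1 - s <= 1 by apply/andP; have /andP[] := s01; lra.
have := CAT0_hinge gX catX gc gf s01.
have := CAT0_hinge gX catX (geodesic_rev gf) (geodesic_rev ge) s01'.
rewrite (metric_sym y' x) (metric_sym y' x').
have rv l : l - (1 - s) * l = s * l by ring.
rewrite !rv.
by have := metric_triangle (c (s * mdist x y)) (f (s * mdist x y')) (e (s * mdist x' y')); lra.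
Qed.

(** By convexity on [[0, T]], the far ends contribute at most [t / T] times a bounded quantity,
    which vanishes as [T] grows. *)
Lemma CAT0_asymptotic c e : geodesic_space X -> CAT0 X ->
  geodesic_ray c -> geodesic_ray e -> asymptotic c e ->
  forall t, 0 <= t -> mdist (c t) (e t) <= mdist (c 0) (e 0).
Proof.
move=> gX catX rc re [B cB] t t0; apply/ler_addgt0Pl => eps eps0.
pose T := t * (`|B| / eps) + t + 1.
have B0 := normr_ge0 B; have BB := ler_norm B.
have TB0 : 0 <= t * (`|B| / eps) by rewrite mulr_ge0// divr_ge0// ltW.
have T0 : 0 < T by rewrite /T; lra.
have s01 : 0 <= t / T <= 1.
  apply/andP; split; first by apply: divr_ge0 => //; exact: ltW.
  by rewrite ler_pdivrMr// mul1r /T; lra.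
have := CAT0_quadrilateral gX catX (ray_geodesic rc (ltW T0)) (ray_geodesic re (ltW T0)) s01.
rewrite (geodesic_ray_dist0 rc (ltW T0)) (geodesic_ray_dist0 re (ltW T0)).
rewrite (divfK (lt0r_neq0 T0)).
have /andP[s0 s1] := s01.
have d0 := mdist_ge0 (c 0) (e 0).
have cBT := cB T (ltW T0).
have : t / T * `|B| <= eps.
  rewrite mulrAC ler_pdivrMr// /T.
  have -> : eps * (t * (`|B| / eps) + t + 1) = t * `|B| + eps * (t + 1).
    by field; rewrite gt_eqF.
  by rewrite lerDl mulr_ge0 ?ltW//; lra.
have : t / T * mdist (c T) (e T) <= t / T * `|B| by rewrite ler_wpM2l//; lra.
have : t / T * mdist (c 0) (e 0) >= 0 by rewrite mulr_ge0.
move: (t / T) s0 s1 s01 => s s0 s1 s01; lra.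
Qed.

End CAT0Geometry.

(** * Axial isometries and cone convergence; inverses and conjugates of hyperbolic isometries *)

Section AxialIsometries.
Context {R : realType} {X : metricType R} {G : topologicalGroupType}.
Variable act : G -> X -> X.
Hypothesis isomG : isometric_action act.
Local Open Scope group_scope.
Local Open Scope ring_scope.
Implicit Types (g h x : G) (o p : X) (c e : R -> X).

Let actM := actM isomG.
Let actD := actD isomG.
Let act1 := act1 isomG.

Lemma geodesic_line_ray (c : R -> X) : geodesic_line c -> geodesic_ray c.
Proof. by move=> lc s t _ _; exact: lc. Qed.

Lemma axis_expg g c (k : R) n : (forall t, act g (c t) = c (t + k)) ->
  act (g ^+ n)%g (c 0) = c (n%:R * k).
Proof.
move=> gc; elim: n => [|n IHn]; first by rewrite expg0 act1 mul0r.
by rewrite expgS actM IHn gc -natr1 mulrDl mul1r.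
Qed.

Lemma axis_escapes g : has_axis act g -> linear_escape act g.
Proof.
move=> [c [lc [k k0 gc]]] o; exists k^-1, (2 * mdist o (c 0)).
split=> [|n]; first by rewrite invr_gt0.
have nk : n%:R * k = mdist (c 0) (act (g ^+ n)%g (c 0)).
  rewrite (axis_expg _ gc) (geodesic_ray_dist0 (geodesic_line_ray lc))//.
  by rewrite mulr_ge0 ?(ltW k0).
rewrite -(ler_pM2r k0) mulrAC mulVf ?gt_eqF// mul1r nk.
have := metric_triangle (c 0) o (act (g ^+ n)%g (c 0)).
have := metric_triangle o (act (g ^+ n)%g o) (act (g ^+ n)%g (c 0)).
by rewrite actD (metric_sym (c 0) o); lra.
Qed.

Lemma axis_tracks g c (k : R) : 0 < k -> (forall t, act g (c t) = c (t + k)) ->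
  tracks act g c.
Proof.
move=> k0 gc; exists 0 => n; exists (n%:R * k); first by rewrite mulr_ge0 ?(ltW k0).
by rewrite (axis_expg _ gc) mdistxx.
Qed.

(** The geodesic from [c 0] to a far point of the axis is near [c r] by cone convergence, and near
    [gam r] by convexity. *)
Lemma cone_cvg_tracks g xi c : geodesic_space X -> CAT0 X -> has_axis act g ->
  geodesic_ray c -> xi c ->
  (forall o, cone_cvg (fun n => act (g ^+ n)%g o) xi) -> tracks act g c.
Proof.
move=> gX catX [gam [lgam [k k0 ggam]]] rc xc gxi.
have rgam := geodesic_line_ray lgam.
set D := mdist (c 0) (gam 0); have D0 : 0 <= D by exact: mdist_ge0.
exists (3 * D + 1) => n; exists (n%:R * k); first by rewrite mulr_ge0 ?(ltW k0).
set r := n%:R * k; have r0 : 0 <= r by rewrite mulr_ge0 ?(ltW k0).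
suff near : mdist (gam r) (c r) <= 2 * D + 1.
  have := metric_triangle (act (g ^+ n)%g (c 0)) (act (g ^+ n)%g (gam 0)) (c r).
  by rewrite actD (axis_expg _ ggam) -/r -/D; lra.
have [r00|rN0] := eqVneq r 0; first by rewrite r00 metric_sym -/D; lra.
have {}rN0 : 0 < r by rewrite lt_neqAle eq_sym rN0.
have [n0 _ n0P] := gxi (gam 0) c xc r 1 rN0 ltr01.
(* The maximum also ensures that the far point [gam L] of the axis lies beyond [gam r]. *)
have [rl near] := n0P (maxn n0 n) (leq_maxl _ _).
move: rl near; rewrite (axis_expg _ ggam); set L := _%:R * k => rl near.
have rL : r <= L by rewrite ler_pM2r// ler_nat leq_maxr.
have L0 : 0 <= L by lra.
set l := mdist (c 0) (gam L) in rl near.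
have l0 : 0 < l by lra.
have [s gs] := gX (c 0) (gam L); have {}near := near s gs.
have sig01 : 0 <= r / l <= 1.
  apply/andP; split; first by apply: divr_ge0 => //; exact: ltW.
  by rewrite ler_pdivrMr// mul1r ltW.
have := CAT0_quadrilateral gX catX gs (ray_geodesic rgam L0) sig01.
rewrite -/l (divfK (lt0r_neq0 l0)) (geodesic_ray_dist0 rgam L0) mdistxx mulr0 addr0 -/D.
have /andP[sg0 sg1] := sig01.
have lL : `|l - L| <= D.
  have := metric_triangle (c 0) (gam 0) (gam L).
  have := metric_triangle (gam 0) (c 0) (gam L).
  rewrite (geodesic_ray_dist0 rgam L0) -/l (metric_sym (gam 0) (c 0)) -/D.
  by rewrite ler_norml => ? ?; apply/andP; lra.
have : mdist (gam (r / l * L)) (gam r) <= r / l * D.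
  rewrite lgam; have -> : r / l * L - r = r / l * (L - l).
    by field; rewrite gt_eqF.
  by rewrite normrM (ger0_norm sg0) ler_wpM2l// distrC.
have := metric_triangle (gam r) (gam (r / l * L)) (c r).
have := metric_triangle (gam (r / l * L)) (s r) (c r).
rewrite (metric_sym (gam r) (gam (r / l * L))) (metric_sym (gam (r / l * L)) (s r)).
have : r / l * D <= D by rewrite ler_piMl.
have : (1 - r / l) * D <= D - r / l * D by rewrite mulrBl mul1r.
by lra.
Qed.

(** The hinge inequality at [e 0] shrinks the bounded distance from the orbit point to the ray by
    the factor [r / l], which tends to 0 as the orbit escapes. *)
Lemma tracks_cone_cvg g c o : geodesic_space X -> CAT0 X ->
  geodesic_ray c -> escapes act g -> tracks act g c ->
  cone_cvg (fun n => act (g ^+ n)%g o) (ray_class c).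
Proof.
move=> gX catX rc eg gc e [re ce] r eps r0 eps0.
have [C cC] := tracks_pt isomG o (asymptotic_tracks isomG ce gc).
have C0 : 0 <= C by have [t _] := cC 0%N; apply: le_trans; exact: mdist_ge0.
have [N eN] := eg o (mdist o (e 0) + r + 2 * r * C / eps + 1).
exists N => // n /= Nn; set y := act _ o; set l := mdist (e 0) y.
have K0 : 0 <= 2 * r * C / eps.
  by apply: divr_ge0; [apply: mulr_ge0 => //; lra|exact: ltW].
have lr : r + 2 * r * C / eps + 1 <= l.
  have := eN n Nn; have := metric_triangle o (e 0) y; rewrite -/y -/l; lra.
have l0 : 0 < l by lra.
split=> [|s gs]; first by lra.
have [t t0 tC] := cC n; rewrite -/y in tC.
have sig01 : 0 <= r / l <= 1.
  apply/andP; split; first by apply: divr_ge0 => //; exact: ltW.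
  by rewrite ler_pdivrMr// mul1r; lra.
have := CAT0_hinge gX catX gs (ray_geodesic re t0) sig01.
rewrite -/l (divfK (lt0r_neq0 l0)) (geodesic_ray_dist0 re t0).
have /andP[sg0 sg1] := sig01.
have lt : `|l - t| <= C.
  have := metric_triangle (e 0) (e t) y; have := metric_triangle (e 0) y (e t).
  rewrite (geodesic_ray_dist0 re t0) -/l (metric_sym (e t) y).
  by rewrite ler_norml => ? ?; apply/andP; lra.
have : mdist (e (r / l * t)) (e r) <= r / l * C.
  rewrite (re _ _ (mulr_ge0 sg0 t0) (ltW r0)); have -> : r / l * t - r = r / l * (t - l).
    by field; rewrite gt_eqF.
  by rewrite normrM (ger0_norm sg0) ler_wpM2l// distrC.
have : r / l * mdist y (e t) <= r / l * C by rewrite ler_wpM2l.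
have := metric_triangle (s r) (e (r / l * t)) (e r).
suff : 2 * (r / l * C) < eps by lra.
have -> : 2 * (r / l * C) = (2 * r * C) / l by field; rewrite gt_eqF.
rewrite ltr_pdivrMr//.
have : 2 * r * C / eps < l by lra.
by rewrite ltr_pdivrMr// (mulrC l).
Qed.

Lemma has_axisV g : has_axis act g -> has_axis act g^-1%g.
Proof.
move=> [c [lc [k k0 gc]]]; exists (fun t => c (- t)); split.
  by move=> s t; rewrite lc -normrN; congr (`|_|); ring.
exists k => // t; have -> : c (- t) = act g (c (- (t + k))).
  by rewrite gc; congr c; ring.
by rewrite (actVK isomG).
Qed.

Lemma has_axisJ g x : has_axis act g -> has_axis act (g ^ x^-1)%g.
Proof.
move=> [c [lc [k k0 gc]]]; exists (act x \o c); split.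
  by move=> s t; rewrite /= actD.
by exists k => // t; rewrite /= -gc conjgE invgK !actM (actVK isomG).
Qed.

Lemma expgzV g (n : int) : expgz g^-1%g n = expgz g (- n).
Proof.
case: n => [[|n]|n] /=; rewrite ?expg0 //; first by rewrite expVgn.
by rewrite expVgn invgK.
Qed.

Lemma qi_embedded_orbitV g o : qi_embedded_orbit act g o ->
  qi_embedded_orbit act g^-1%g o.
Proof.
move=> [L [A [L1 A0 LA]]]; exists L, A; split => // m n.
have := LA (- m) (- n); rewrite !expgzV.
by have -> : `|- m - - n| = `|m - n| by rewrite -normrN; congr (`|_|); ring.
Qed.

Lemma expgzJ g x n : expgz (g ^ x^-1)%g n = (expgz g n ^ x^-1)%g.
Proof. by case: n => n /=; rewrite -conjXg ?conjVg. Qed.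

Lemma qi_embedded_orbitJ g x o : qi_embedded_orbit act g o ->
  qi_embedded_orbit act (g ^ x^-1)%g (act x o).
Proof.
move=> [L [A [L1 A0 LA]]]; exists L, A; split => // m n.
by rewrite !expgzJ !conjgE !invgK !actM !(actVK isomG) actD; exact: LA.
Qed.

End AxialIsometries.

(** * Statements common to both kinds of NPC spaces *)

Section NPC.
Context {R : realType} {X : metricType R} {G : topologicalGroupType}.
Variables (act : G -> X -> X) (k : npc_case).
Hypotheses (isomG : isometric_action act) (npcX : npc_space k X).
Implicit Types (g h x : G) (o : X) (c : R -> X) (xi : set (R -> X)).

Lemma hyperbolicV g : hyperbolic act k g -> hyperbolic act k g^-1%g.
Proof.
case: k => /=; first exact: has_axisV.
by move=> [p gp]; exists p; exact: qi_embedded_orbitV.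
Qed.

Lemma hyperbolicJ g x : hyperbolic act k g -> hyperbolic act k (g ^ x^-1)%g.
Proof.
case: k => /=; first exact: has_axisJ.
by move=> [p gp]; exists (act x p); exact: qi_embedded_orbitJ.
Qed.

Lemma hyperbolic_linear_escape g : hyperbolic act k g -> linear_escape act g.
Proof. by case: k => /=; [exact: axis_escapes|exact: qi_linear_escape]. Qed.

Lemma hyperbolic_escapes g : hyperbolic act k g -> escapes act g.
Proof. by move=> /hyperbolic_linear_escape; exact: linear_escape_escapes. Qed.

Lemma npc_asymptotic_bound : exists C : R, asymptotic_bound (X := X) C.
Proof.
case: k npcX => -[gX].
  move=> [_ catX]; exists 0 => c1 c2 r1 r2 c12 t t0.
  have := CAT0_asymptotic gX catX r1 r2 c12 t0.
  by have := mdist_ge0 (c1 0) (c2 0); lra.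
move=> [_ [delta d0 dX]]; exists (4 * `|3 * delta + 1|) => c1 c2 r1 r2 c12.
exact: four_point_asymptotic (thin_four_point gX d0 dX) r1 r2 c12.
Qed.

Lemma attracting_tracks g xi c : hyperbolic act k g -> attracting_point act k g xi ->
  xi c -> tracks act g c.
Proof.
move=> hg [bxi gxi] xc; have rc := boundary_ray bxi xc.
have lg := hyperbolic_linear_escape hg.
case: k npcX hg gxi => -[gX].
  by move=> [_ catX] hg gxi; exact: (cone_cvg_tracks isomG gX catX hg rc xc).
move=> [_ [delta d0 dX]] _ gxi.
apply: (gromov_cvg_tracks isomG (thin_four_point gX d0 dX) _ lg rc xc).
  by lra.
exact: gxi.
Qed.

Lemma tracks_attracting g c : hyperbolic act k g -> geodesic_ray c ->
  tracks act g c -> attracting_point act k g (ray_class c).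
Proof.
move=> /hyperbolic_escapes eg rc gc; split; first exact: ray_class_boundary.
move=> o; case: k npcX => -[gX]; last by move=> _; exact: tracks_gromov_cvg.
by move=> [_ catX]; exact: tracks_cone_cvg.
Qed.

(** Applied to an inverse, this supplies the repelling point, whose existence is not part of
    [hyperbolic]. *)
Lemma exists_tracked_ray g : hyperbolic act k g ->
  exists2 c, geodesic_ray c & tracks act g c.
Proof.
move=> hg; have lg := hyperbolic_linear_escape hg.
case: k npcX hg => -[gX].
  move=> _ [c [lc [m m0 gc]]]; exists c; first exact: geodesic_line_ray.
  exact: axis_tracks gc.
move=> [pX [delta d0 dX]] [p _].
apply: (exists_tracked_ray_proper isomG p gX pX (thin_four_point gX d0 dX)) lg.
by lra.
Qed.

End NPC.

(** * The scale of hyperbolic elements *)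

(** Two terms fall into the same coset of [U], namely that of a cluster point of the sequence. *)
Lemma compact_recurrence (G : topologicalGroupType) (U K : set G) (y_ : nat -> G) :
  compact K -> subgroup U -> open U -> (forall n, K (y_ n)) ->
  exists m n, (m < n)%N /\ U ((y_ m)^-1 * y_ n)%g.
Proof.
move=> Kco [U1 UM UV] Uo Ky.
have [|p [_ clp]] := Kco (y_ @ \oo) _; first by exists 0%N => // n _; exact: Ky.
have pU : nbhs p [set z | U (p^-1 * z)%g].
  apply: mulgl_continuous; rewrite mulVg; exact: open_nbhs_nbhs.
have pP N : exists2 n, (N <= n)%N & U (p^-1 * y_ n)%g.
  have [|_ [[n /= Nn <-] pn]] := clp [set y_ n | n in [set n | (N <= n)%N]] _ _ pU.
    by exists N => // n Nn; exists n.
  by exists n.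
have [m _ pm] := pP 0%N; have [n mn pn] := pP m.+1.
exists m, n; split => //.
have -> : ((y_ m)^-1 * y_ n = (p^-1 * y_ m)^-1 * (p^-1 * y_ n))%g.
  by rewrite invgM invgK mulgA mulgK.
by apply: UM => //; exact: UV.
Qed.

Section ScaleAtBoundary.
Context {R : realType} {X : metricType R} {G : topologicalGroupType}.
Variables (act : G -> X -> X) (k : npc_case).
Hypotheses (npcX : npc_space k X) (tdlcG : tdlc G) (isomG : isometric_action act)
  (properG : proper_action act) (contG : continuous_action act).
Implicit Types (g h x : G) (o : X) (c : R -> X) (xi : set (R -> X)) (U : set G).

Lemma compact_bounded U o : compact U ->
  exists B : R, forall u, U u -> mdist (act u o) o <= B.
Proof.
move=> /compact_near_coveringP Uco.
have /filter_ex[B UB] : \forall B \near +oo, U `<=` (fun u => mdist (act u o) o <= B).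
  apply: Uco => u _.
  have : nbhs u ((fun f => act f o) @^-1` ball (act u o) 1).
    apply: (@continuous_comp _ _ _ (fun f => (f, o)) (fun z => act z.1 z.2)).
    - by apply: cvg_pair; [exact: cvg_id|exact: cvg_cst].
    - exact: contG.
    - exact: nbhsx_ballx.
  move=> nu; exists ((fun f => act f o) @^-1` ball (act u o) 1,
      [set B | mdist (act u o) o + 1 < B]).
    by split => //; exists (mdist (act u o) o + 1); split; rewrite ?num_real.
  move=> [f B] [/=]; rewrite ballEmdist /= => fu uB.
  by have := metric_triangle (act f o) (act u o) o; rewrite metric_sym in fu; lra.
by exists B.
Qed.

Lemma stab_orbit_bounded g xi o : hyperbolic act k g -> attracting_point act k g xi ->
  exists B : R, forall x, boundary_stab act xi x -> forall n,
    mdist (act (x ^ g ^+ n)%g o) o <= 3 * mdist (act x o) o + B.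
Proof.
move=> hg gxi; have [c rc xiE] := gxi.1.
have gc := attracting_tracks isomG npcX hg gxi; rewrite xiE in gc *.
have {}gc := gc c (ray_class_refl rc).
have [C CP] := npc_asymptotic_bound npcX.
have [B BP] := stab_bounded isomG o CP rc gc; exists B => x.
move=> /(boundary_stab_class isomG x rc) xc n.
by rewrite act_conj_dist//; exact: BP.
Qed.

Lemma orbit_bounded_stab g xi o x : hyperbolic act k g -> attracting_point act k g xi ->
  (exists B : R, forall n, mdist (act (x ^ g ^+ n)%g o) o <= B) ->
  boundary_stab act xi x.
Proof.
move=> hg gxi [B BP]; have [c rc xiE] := gxi.1.
have gc := attracting_tracks isomG npcX hg gxi; rewrite xiE in gc *.
have {}gc := gc c (ray_class_refl rc).
apply/(boundary_stab_class isomG x rc).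
apply: (bounded_asymptotic isomG (o := o) rc (hyperbolic_escapes isomG hg) gc).
by exists B => n; rewrite -(act_conj_dist isomG).
Qed.

Lemma conj_stable_stab g xi U : hyperbolic act k g -> attracting_point act k g xi ->
  compact U -> (forall u, U u -> U (u ^ g)%g) -> U `<=` boundary_stab act xi.
Proof.
move=> hg gxi Uco Ug u Uu; have [c _ _] := gxi.1.
have [B BP] := compact_bounded (c 0) Uco.
apply: (orbit_bounded_stab (o := c 0) hg gxi); exists B => n; apply: BP.
by elim: n => [|n IHn]; rewrite ?conjg1// expgSr conjgM; exact: Ug.
Qed.

Lemma bounded_conj_invariant a V o B : compact_open_subgroup V ->
  (forall x, (forall i, V (x ^ a^-1 ^+ i)%g) -> forall n,
     mdist (act (x ^ a ^+ n)%g o) o <= B) ->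
  exists2 U, compact_open_subgroup U & forall u, U u -> U (u ^ a)%g.
Proof.
move=> Vco VB.
(* Properness turns the bound into a compact set, but is stated for positive radii. *)
have r0 : 0 < `|B| + 1 by rewrite ltr_wpDl.
apply: (exists_conj_invariant Vco (@properG o _ r0)) => x xV n.
apply: subset_closure => /=; apply: (le_trans (VB x xV n)).
by have := ler_norm B; lra.
Qed.

Lemma scaleV_open_stab g xi : hyperbolic act k g -> attracting_point act k g xi ->
  open (boundary_stab act xi) -> scale g^-1%g = 1%N.
Proof.
move=> hg gxi So; have [c _ _] := gxi.1; pose o := c 0.
have [V [Vg Vco Vo]] := exists_compact_open_subgroup tdlcG.
have Sg := boundary_stab_subgroup isomG xi.
have VSco : compact_open_subgroup (V `&` boundary_stab act xi).
  have VSg := subgroupI Vg Sg.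
  apply: (compact_open_subgroup_sub VSg _ Vco (@subIsetl _ _ _)).
  by apply: open_nbhs_nbhs; split; [exact: openI|case: VSg].
have [B BP] := compact_bounded o Vco.
have [C CP] := stab_orbit_bounded o hg gxi.
have [|U Uco Ug] := @bounded_conj_invariant g _ o (3 * B + C) VSco.
  (* Index 0 of the hypothesis says that [x] itself lies in [V] and fixes [xi]. *)
  move=> x /(_ 0%N); rewrite expg0 conjg1 => -[/BP xB /CP/(_ _)] xC n.
  by have := xC n; lra.
by apply: (scale_eq1 tdlcG Uco) => u /Ug; rewrite invgK.
Qed.

Lemma scaleV_not_open_stab g xi : hyperbolic act k g -> attracting_point act k g xi ->
  ~ open (boundary_stab act xi) -> (1 < scale g^-1%g)%N.
Proof.
move=> hg gxi nSo; apply: (scale_gt1 tdlcG) => U [[U1 _ _] Uco Uo].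
rewrite invgK => Ug; apply: nSo.
apply: subgroup_open; first exact: boundary_stab_subgroup.
apply: filterS (conj_stable_stab hg gxi Uco Ug) _.
exact: open_nbhs_nbhs.
Qed.

(** The conjugate of [g] by [x] again attracts to [xi], so the arrow makes [xi'] its repelling
    point; but this point is also the image of [xi'] under [x]. *)
Lemma arrow_stab xi xi' g : hyperbolic act k g -> attracting_point act k g xi ->
  hyp_arrow act k xi xi' -> boundary_stab act xi `<=` boundary_stab act xi'.
Proof.
move=> hg gxi arr x xx.
have gxi' : repelling_point act k g xi' by exact: arr.
have [c rc xiE] := gxi.1; have [c' rc' xiE'] := gxi'.1.
have hgx : hyperbolic act k (g ^ x^-1)%g by exact: hyperbolicJ.
have hgV : hyperbolic act k g^-1%g by exact: hyperbolicV.
have hgxV : hyperbolic act k (g ^ x^-1)^-1%g by exact: hyperbolicV.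
have xc : xi c by rewrite xiE; exact: ray_class_refl.
have xc' : xi' c' by rewrite xiE'; exact: ray_class_refl.
have gc := attracting_tracks isomG npcX hg gxi xc.
have gc' := attracting_tracks isomG npcX hgV gxi' xc'.
have gxxi : attracting_point act k (g ^ x^-1)%g xi.
  rewrite -xx xiE boundary_act_class//.
  apply: (tracks_attracting isomG npcX hgx); first exact: geodesic_ray_act.
  exact: tracks_conj.
have gxc' := attracting_tracks isomG npcX hgxV (arr _ hgx gxxi) xc'.
rewrite xiE'; apply/(boundary_stab_class isomG x rc').
apply: (tracks_asymptotic isomG _ rc' (hyperbolic_escapes isomG hgxV) _ gxc').
  exact: geodesic_ray_act.
by rewrite -conjVg; exact: tracks_conj.
Qed.

Lemma scale_arrow g xi xi' : hyperbolic act k g -> attracting_point act k g xi ->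
  hyp_arrow act k xi xi' -> scale g = 1%N.
Proof.
move=> hg gxi arr; have [c _ _] := gxi.1; pose o := c 0.
have gxi' : repelling_point act k g xi' by exact: arr.
have hgV : hyperbolic act k g^-1%g by exact: hyperbolicV.
have [V Vco] := exists_compact_open_subgroup tdlcG.
have [B BP] := compact_bounded o (let: And3 _ Vk _ := Vco in Vk).
have [C CP] := stab_orbit_bounded o hgV gxi'.
have [|U Uco Ug] := @bounded_conj_invariant g^-1%g _ o (3 * B + C) Vco.
  (* With [g^-1] in the role of [a], the hypothesis bounds the conjugates of [x] by powers of [g];
     so [x] fixes [xi], hence [xi'], which bounds the conjugates by powers of [g^-1]. *)
  rewrite invgK => x Vx n.
  have xx : boundary_stab act xi x.
    by apply: (orbit_bounded_stab (o := o) hg gxi); exists B => i; exact/BP/Vx.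
  have := CP x (arrow_stab hg gxi arr xx) n.
  by have := BP _ (Vx 0%N); rewrite expg0 conjg1; lra.
exact: (scale_eq1 tdlcG Uco).
Qed.

(* Recurrence of the forward orbit of [x] under conjugation by [g] makes its
   backward orbit periodic modulo [U], hence bounded. *)
Lemma conj_stable_stab_sub g xi xi' U : hyperbolic act k g ->
  attracting_point act k g xi -> repelling_point act k g xi' ->
  compact_open_subgroup U -> (forall u, U u -> U (u ^ g^-1)%g) ->
  boundary_stab act xi `<=` boundary_stab act xi'.
Proof.
move=> hg gxi gxi' [Ugr Uco Uo] Ug x xx; have [c _ _] := gxi.1; pose o := c 0.
have hgV : hyperbolic act k g^-1%g by exact: hyperbolicV.
have [C CP] := stab_orbit_bounded o hg gxi.
have r0 : 0 < `|3 * mdist (act x o) o + C| + 1 by rewrite ltr_wpDl.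
have [|m [n [mn Umn]]] := @compact_recurrence G U _ (fun n => x ^ g ^+ n)%g
    (@properG o _ r0) Ugr Uo.
  move=> n; apply: subset_closure => /=; apply: (le_trans (CP x xx n)).
  by have := ler_norm (3 * mdist (act x o) o + C); lra.
have [U1 UM UV] := Ugr.
have UgV j u : U u -> U (u ^ g^-1 ^+ j)%g.
  by elim: j u => [|j IHj] u Uu; rewrite ?conjg1// expgSr conjgM; exact/Ug/IHj.
pose x_ j := (x ^ g^-1 ^+ j)%g; pose p := (n - m)%N.
have p0 : (0 < p)%N by rewrite subn_gt0.
have yE i l : ((x ^ g ^+ i) ^ g^-1 ^+ (i + l) = x_ l)%g.
  by rewrite expgnDr conjgM expVgn conjgK.
(* Conjugation by the power [n + j] of [g^-1] carries the recurrence at [m] and [n] to the indices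
   [j + p] and [j]. *)
have period j : U ((x_ j)^-1 * x_ (j + p)%N)%g.
  have := UV _ (UgV (n + j)%N _ Umn); rewrite conjMg conjVg yE.
  have -> : (n + j = m + (j + p))%N by rewrite /p; lia.
  by rewrite yE invgM invgK.
have [B BP] := compact_bounded o Uco.
apply: (orbit_bounded_stab (o := o) hgV gxi').
(* The sum serves as an upper bound for the displacements over one period. *)
exists (\sum_(i < p) mdist (act (x_ i) o) o + B) => j.
have [i ip Uij] : exists2 i, (i < p)%N & U ((x_ i)^-1 * x_ j)%g.
  elim/ltn_ind: j => j IHj; have [jp|pj] := ltnP j p.
    by exists j; rewrite ?mulVg.
  have [|i ip Ui] := IHj (j - p)%N; first by rewrite ltn_subrL p0 (leq_trans p0).
  exists i => //; have := period (j - p)%N; rewrite subnK// => Uj.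
  by have := UM _ _ Ui Uj; rewrite mulgA mulgK.
have [_ actM actD] := isomG.
have := BP _ Uij; rewrite actM (act_distl isomG) invgK.
have : mdist (act (x_ i) o) o <= \sum_(i < p) mdist (act (x_ i) o) o.
  rewrite (bigD1 (Ordinal ip))//= lerDl; apply: sumr_ge0 => ? _; exact: mdist_ge0.
have := metric_triangle (act (x_ j) o) (act (x_ i) o) o.
lra.
Qed.

Lemma scale_no_arrow g xi : hyperbolic act k g -> attracting_point act k g xi ->
  ~ (exists2 xi', hyp_boundary act k xi' & hyp_arrow act k xi xi') ->
  (1 < scale g)%N.
Proof.
move=> hg gxi narr; apply: (scale_gt1 tdlcG) => U Uco Ug; apply: narr.
have hgV : hyperbolic act k g^-1%g by exact: hyperbolicV.
have [c' rc' gc'] := exists_tracked_ray isomG npcX hgV.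
have gxi' : repelling_point act k g (ray_class c').
  exact: (tracks_attracting isomG npcX hgV rc' gc').
exists (ray_class c'); first by exists g => //; right.
move=> h hh hxi; have [c rc xiE] := gxi.1.
have xc : xi c by rewrite xiE; exact: ray_class_refl.
have gc := attracting_tracks isomG npcX hg gxi xc.
have hc := attracting_tracks isomG npcX hh hxi xc.
have [C CP] := npc_asymptotic_bound npcX.
have hhV : hyperbolic act k h^-1%g by exact: hyperbolicV.
apply: (tracks_attracting isomG npcX hhV rc').
(* The essential condition left is that [h] fixes the repelling point of [g]; this follows from its
   fixing [xi], its own attracting point. *)
apply: (tracks_inverse isomG CP rc rc' _ _ gc hc gc').
- exact: (hyperbolic_escapes isomG hg).
- exact: (hyperbolic_escapes isomG hgV).
- apply/(boundary_stab_class isomG h rc').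
  apply: (conj_stable_stab_sub hg gxi gxi' Uco Ug).
  rewrite xiE; apply/(boundary_stab_class isomG h rc).
  exact: (tracks_stab isomG rc (hyperbolic_escapes isomG hh) hc).
Qed.

End ScaleAtBoundary.

Theorem corollary1p5 (R : realType) (X : metricType R) (G : topologicalGroupType)
    (act : G -> X -> X) (k : npc_case) (xi : set (R -> X))
    (npcX : npc_space k X) (tdlcG : tdlc G)
    (isomG : isometric_action act) (properG : proper_action act)
    (contG : continuous_action act) (xi_hyp : hyp_boundary act k xi) :
  [/\ (exists2 xi', hyp_boundary act k xi' & hyp_arrow act k xi xi') ->
        forall g, hyp_attracted_to act k xi g -> scale g = 1%N,
      ~ (exists2 xi', hyp_boundary act k xi' & hyp_arrow act k xi xi') ->
        forall g, hyp_attracted_to act k xi g -> (1 < scale g)%N,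
      open (boundary_stab act xi) ->
        forall g, hyp_attracted_to act k xi g -> scale (g^-1)%g = 1%N &
      ~ open (boundary_stab act xi) ->
        forall g, hyp_attracted_to act k xi g -> (1 < scale (g^-1)%g)%N].
Proof.
split.
- move=> [xi' _ arr] g [hg gxi].
  exact: (scale_arrow npcX tdlcG isomG properG contG hg gxi arr).
- move=> narr g [hg gxi].
  exact: (scale_no_arrow npcX tdlcG isomG properG contG hg gxi narr).
- move=> So g [hg gxi].
  exact: (scaleV_open_stab npcX tdlcG isomG properG contG hg gxi So).
- move=> nSo g [hg gxi].
  exact: (scaleV_not_open_stab npcX tdlcG isomG contG hg gxi nSo).
Qed.
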